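(* Let $(M,G=g+F)$ be a generalized Riemannian manifold, let $A$ be the $(1,1)$-tensor with $F(X,Y)=g(AX,Y)$, and let $\nabla^g$ be the Levi-Civita connection of $g$. (a) A linear connection $\nabla$ preserves $G$ if and only if it preserves its symmetric part $g$ and its skew-symmetric part $F$: $\nabla G=0\Leftrightarrow \nabla g=\nabla F=0\Leftrightarrow \nabla g=\nabla A=0$. (b) If there exists a linear connection $\nabla$ with torsion $T$ preserving $G$, $\nabla G=0$, then $$(\nabla^g_XF)(Y,Z)=-\tfrac12\big[T(X,Y,AZ)+T(Z,X,AY)\big]-\tfrac12\big[T(AZ,X,Y)+T(AZ,Y,X)+T(X,AY,Z)+T(Z,AY,X)\big].\quad(1)$$ In particular, $$dF(X,Y,Z)=F(T(X,Y),Z)+F(T(Y,Z),X)+F(T(Z,X),Y),$$ equivalently $dF(X,Y,Z)=-T(X,Y,AZ)-T(Y,Z,AX)-T(Z,X,AY)$. Conversely, if $T$ is a torsion tensor (i.e. a tensor skew-symmetric in its first two arguments) for which (1) holds, then there exists a unique linear connection $\nabla$ with torsion $T$ preserving $G$, and it is determined by $$g(\nabla_XY,Z)=g(\nabla^g_XY,Z)+\tfrac12\big[T(X,Y,Z)+T(Z,X,Y)-T(Y,Z,X)\big].$$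
   Context: A generalized (non-symmetric) Riemannian manifold $(M,G)$ is a smooth manifold with a smooth $(0,2)$-tensor $G=g+F$, where $g(X,Y)=\frac12(G(X,Y)+G(Y,X))$ is the symmetric part, assumed non-degenerate (of arbitrary signature), and $F(X,Y)=\frac12(G(X,Y)-G(Y,X))$ is the skew-symmetric part. The $(1,1)$-tensor $A$ is defined by $F(X,Y)=g(AX,Y)$. The torsion of $\nabla$ is $T(X,Y)=\nabla_XY-\nabla_YX-[X,Y]$, and its $(0,3)$-version is $T(X,Y,Z)=g(T(X,Y),Z)$. The exterior derivative is normalized so that for commuting vector fields $dF(X,Y,Z)=XF(Y,Z)+YF(Z,X)+ZF(X,Y)$. Tensor identities hold for all vector fields $X,Y,Z$. *)

(* Defs.v *)
From HB Require Import structures.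
From mathcomp Require Import all_boot all_order all_algebra.
From mathcomp Require Import all_classical all_reals all_analysis.
From mathcomp Require Import ring.

Set Implicit Arguments.
Unset Strict Implicit.
Unset Printing Implicit Defensive.
Import Order.TTheory GRing.Theory Num.Theory.
Import numFieldNormedType.Exports.
Local Open Scope classical_set_scope.
Local Open Scope ring_scope.

Section SmoothEuclidean.
Variables (R : realType) (n : nat).
Implicit Types (U : set 'rV[R]_n) (f g : 'rV[R]_n -> R).

(* All iterated partial derivatives of order at most k exist and are
   continuous on U, which is meant to be open. *)
Fixpoint Ck (k : nat) U f : Prop :=
  match k with
  | 0 => {in U, continuous f}
  | k'.+1 => {in U, continuous f} /\
      forall i : 'I_n,
        {in U, forall x, derivable f x (delta_mx 0 i)} /\
        Ck k' U (fun x => 'D_(delta_mx 0 i) f x)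
  end.

Definition smooth_on U f := forall k, Ck k U f.

Lemma CkS k U f : Ck k.+1 U f -> Ck k U f.
Proof.
elim: k f => [f []//|k IHk f [cf df]]; split => // i.
by have [? /IHk] := df i.
Qed.

Lemma Ck_continuous k U f : Ck k U f -> {in U, continuous f}.
Proof. by case: k => // k []. Qed.

Lemma near_eq_in U f g x : open U -> x \in U -> {in U, f =1 g} ->
  \near x, f x = g x.
Proof.
move=> oU /[!inE] Ux fg; have := open_nbhs_nbhs (conj oU Ux).
by apply: filterS => y Uy; apply: fg; rewrite inE.
Qed.

Lemma eq_Ck k U f g : open U -> {in U, f =1 g} -> Ck k U f -> Ck k U g.
Proof.
move=> oU; have ctg f' g' : {in U, f' =1 g'} ->
    {in U, continuous f'} -> {in U, continuous g'}.
  move=> fg cf x Ux; rewrite /continuous_at -(fg _ Ux).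
  apply: cvg_trans (cf x Ux); apply: (near_eq_cvg (F := nbhs x)).
  exact: near_eq_in fg.
elim: k f g => [|k IHk] f g fg; first exact: ctg.
move=> [cf df]; split; first exact: ctg cf.
move=> i; have [df1 df2] := df i; split.
  move=> x Ux.
  exact: (near_eq_derivable (near_eq_in oU Ux fg) (df1 x Ux)).
apply: IHk df2 => x Ux /=; exact: (near_eq_derive _ (near_eq_in oU Ux fg)).
Qed.

Lemma Ck_cst k U (a : R) : open U -> Ck k U (fun=> a).
Proof.
move=> oU; elim: k a => [|k IHk] a; first by move=> x _; exact: cst_continuous.
split; first by move=> x _; exact: cst_continuous.
move=> i; split => [x _|]; first exact: derivable_cst.
by apply: (eq_Ck oU _ (IHk 0)) => x _ /=; rewrite derive_cst.
Qed.

Lemma CkD k U f g : open U -> Ck k U f -> Ck k U g -> Ck k U (f \+ g).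
Proof.
move=> oU; elim: k f g => [|k IHk] f g.
  move=> cf cg x Ux; exact: (continuousD (cf x Ux) (cg x Ux)).
move=> [cf df] [cg dg]; split.
  move=> x Ux; exact: (continuousD (cf x Ux) (cg x Ux)).
move=> i; have [df1 df2] := df i; have [dg1 dg2] := dg i; split.
  by move=> x Ux; apply: derivableD; [exact: df1|exact: dg1].
apply: (eq_Ck oU _ (IHk _ _ df2 dg2)) => x Ux /=.
by rewrite deriveD//; [exact: df1|exact: dg1].
Qed.

Lemma CkM k U f g : open U -> Ck k U f -> Ck k U g -> Ck k U (f \* g).
Proof.
move=> oU; elim: k f g => [|k IHk] f g.
  move=> cf cg x Ux; exact: (continuousM (cf x Ux) (cg x Ux)).
move=> Cf Cg; have [cf df] := Cf; have [cg dg] := Cg; split.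
  move=> x Ux; exact: (continuousM (cf x Ux) (cg x Ux)).
move=> i; have [df1 df2] := df i; have [dg1 dg2] := dg i; split.
  by move=> x Ux; apply: derivableM; [exact: df1|exact: dg1].
have := CkD oU (IHk _ _ (CkS Cf) dg2) (IHk _ _ (CkS Cg) df2).
apply: eq_Ck => // x Ux /=.
by rewrite deriveM//; [exact: df1|exact: dg1].
Qed.

End SmoothEuclidean.

Record chart (R : realType) (n : nat) (T : topologicalType) := Chart {
  chart_dom : set T;
  chart_img : set 'rV[R]_n;
  chart_map : T -> 'rV[R]_n;
  chart_inv : 'rV[R]_n -> T;
  chart_dom_open : open chart_dom;
  chart_img_open : open chart_img;
  chart_mapP : {homo chart_map : p / p \in chart_dom >-> p \in chart_img};
  chart_invP : {homo chart_inv : x / x \in chart_img >-> x \in chart_dom};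
  chart_mapK : {in chart_dom, cancel chart_map chart_inv};
  chart_invK : {in chart_img, cancel chart_inv chart_map};
  chart_map_cts : {in chart_dom, continuous chart_map};
  chart_inv_cts : {in chart_img, continuous chart_inv}
}.

Definition compatible_charts (R : realType) (n : nat) (T : topologicalType)
    (c d : chart R n T) :=
  forall j : 'I_n,
    smooth_on (chart_img c `&` chart_inv c @^-1` chart_dom d)
              (fun x => chart_map d (chart_inv c x) 0 j).

(* The atlas need not be maximal: an atlas and the maximal one containing it
   have the same smooth functions. *)
Record manifold (R : realType) (n : nat) := Manifold {
  manifold_space :> topologicalType;
  manifold_hausdorff : hausdorff_space manifold_space;
  manifold_countable : @second_countable manifold_space;
  atlas : set (chart R n manifold_space);
  atlas_cover : forall p, exists2 c, atlas c & chart_dom c p;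
  atlas_compatible : forall c d, atlas c -> atlas d -> compatible_charts c d
}.

Section SmoothFunctions.
Variables (R : realType) (n : nat) (M : manifold R n).

Definition smooth (f : M -> R) :=
  forall c, atlas c -> smooth_on (chart_img c) (f \o chart_inv c).

Definition smooth_pred : {pred M -> R} := fun f => `[< smooth f >].

Lemma smooth_subring : subring_closed smooth_pred.
Proof.
split=> [|f g /asboolP sf /asboolP sg|f g /asboolP sf /asboolP sg];
  apply/asboolP => c ac k; have oU := @chart_img_open _ _ _ c.
- exact: Ck_cst.
- have := CkD oU (sf c ac k) (CkM oU (Ck_cst k (-1) oU) (sg c ac k)).
  by apply: eq_Ck => // x _ /=; rewrite mulN1r.
- exact: CkM (sf c ac k) (sg c ac k).
Qed.

Lemma smooth_scaler : GRing.scaler_closed smooth_pred.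
Proof.
move=> a f /asboolP sf; apply/asboolP => c ac k.
have oU := @chart_img_open _ _ _ c.
exact: CkM (Ck_cst k a oU) (sf c ac k).
Qed.

HB.instance Definition _ :=
  GRing.isSubringClosed.Build (M -> R) smooth_pred smooth_subring.
HB.instance Definition _ :=
  GRing.isScaleClosed.Build R (M -> R) smooth_pred smooth_scaler.

Record Coo := MkCoo { Coo_fun :> M -> R; _ : Coo_fun \in smooth_pred }.

HB.instance Definition _ := [isSub for Coo_fun].
HB.instance Definition _ := [Choice of Coo by <:].
HB.instance Definition _ :=
  GRing.SubChoice_isSubComPzRing.Build (M -> R) smooth_pred Coo smooth_subring.
HB.instance Definition _ := [SubZmodule_isSubLmodule of Coo by <:].

End SmoothFunctions.

Section VectorFields.
Variables (R : realType) (n : nat) (M : manifold R n).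
Local Notation C := (Coo M).

Definition derivation (D : C -> C) :=
  (forall (a : R) (f g : C), D (a *: f + g) = a *: D f + D g) /\
  (forall f g : C, D (f * g) = D f * g + f * D g).

(* The codomain is the regular module, so that functions are scaled by C^oo(M). *)
Definition derivation_pred : {pred C -> C^o} := fun D => `[< derivation D >].

Lemma CooP (f g : C) : (forall p, f p = g p) -> f = g.
Proof. by move=> fg; apply/val_inj/funext. Qed.

Lemma derivation_submod : submod_closed derivation_pred.
Proof.
split=> [|h D E /asboolP[Dl Dm] /asboolP[El Em]]; apply/asboolP; split.
- by move=> a f g; apply: CooP => p /=; rewrite /= scaler0 addr0.
- by move=> f g; rewrite /= mul0r mulr0 addr0.
- move=> a f g; apply: CooP => p.
  have -> : (h *: D + E) (a *: f + g) = h * D (a *: f + g) + E (a *: f + g) by [].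
  rewrite Dl El.
  change (h p * (a * D f p + D g p) + (a * E f p + E g p) =
          a * (h p * D f p + E f p) + (h p * D g p + E g p)).
  by rewrite !mulrDr addrACA [h p * (a * _)]mulrCA.
- move=> f g; apply: CooP => p.
  have -> : (h *: D + E) (f * g) = h * D (f * g) + E (f * g) by [].
  rewrite Dm Em.
  change (h p * (D f p * g p + f p * D g p) + (E f p * g p + f p * E g p) =
          (h p * D f p + E f p) * g p + f p * (h p * D g p + E g p)).
  by rewrite !mulrDr mulrDl addrACA !mulrA [h p * f p]mulrC.
Qed.

HB.instance Definition _ :=
  GRing.isSubmodClosed.Build C (C -> C^o) derivation_pred derivation_submod.

Record vector_field :=
  VectorField { vf_fun : C -> C^o; _ : vf_fun \in derivation_pred }.

HB.instance Definition _ := [isSub for vf_fun].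
HB.instance Definition _ := [Choice of vector_field by <:].
HB.instance Definition _ :=
  GRing.SubChoice_isSubLmodule.Build C (C -> C^o) derivation_pred vector_field
    (GRing.subsemimodClosedP _).

Definition vf_app (X : vector_field) (f : C) : C := vf_fun X f.
Coercion vf_app : vector_field >-> Funclass.

Lemma vf_derivation (X : vector_field) : derivation X.
Proof. by case: X => D dD; exact: (asboolW dD). Qed.

Lemma bracket_derivation (X Y : vector_field) :
  (fun f : C => X (Y f) - Y (X f) : C^o) \in derivation_pred.
Proof.
have [Xl Xm] := vf_derivation X; have [Yl Ym] := vf_derivation Y.
have XD f g : X (f + g) = X f + X g.
  by rewrite -[f]scale1r Xl !scale1r.
have YD f g : Y (f + g) = Y f + Y g.
  by rewrite -[f]scale1r Yl !scale1r.
apply/asboolP; split.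
  by move=> a f g; rewrite Yl Xl Xl Yl scalerBr opprD addrACA.
move=> f g; rewrite Ym Xm XD YD !Xm !Ym mulrBl mulrBr.
apply: CooP => p.
change ((X (Y f) p * g p + Y f p * X g p) +
    (X f p * Y g p + f p * X (Y g) p) -
    ((Y (X f) p * g p + X f p * Y g p) +
    (Y f p * X g p + f p * Y (X g) p)) =
  X (Y f) p * g p - Y (X f) p * g p +
  (f p * X (Y g) p - f p * Y (X g) p)).
ring.
Qed.

Definition bracket (X Y : vector_field) := VectorField (bracket_derivation X Y).

End VectorFields.

(* Tensor fields are C^oo(M)-multilinear maps on vector fields. *)
Section Tensors.
Variables (R : realType) (n : nat) (M : manifold R n).
Local Notation C := (Coo M).
Local Notation V := (vector_field M).

Definition is_tensor02 (B : V -> V -> C) :=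
  (forall (f : C) X X' Y, B (f *: X + X') Y = f * B X Y + B X' Y) /\
  (forall (f : C) X Y Y', B X (f *: Y + Y') = f * B X Y + B X Y').

Definition is_tensor11 (A : V -> V) :=
  forall (f : C) X X', A (f *: X + X') = f *: A X + A X'.

Definition is_tensor12 (T : V -> V -> V) :=
  (forall (f : C) X X' Y, T (f *: X + X') Y = f *: T X Y + T X' Y) /\
  (forall (f : C) X Y Y', T X (f *: Y + Y') = f *: T X Y + T X Y').

Definition sym_part (G : V -> V -> C) X Y : C := 2^-1 *: (G X Y + G Y X).

Definition skew_part (G : V -> V -> C) X Y : C := 2^-1 *: (G X Y - G Y X).

(* Non-degeneracy at every point p: since g is C^oo(M)-bilinear, g X Y p only
   depends on the values of X and Y at p, and every tangent vector at p is the
   value of a vector field. *)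
Definition nondegenerate (g : V -> V -> C) :=
  forall (p : M) (X : V), (forall Y, g X Y p = 0) -> forall f : C, X f p = 0.

Definition generalized_riemannian (G : V -> V -> C) :=
  is_tensor02 G /\ nondegenerate (sym_part G).

(* R-linearity in Y follows from the Leibniz rule, as X kills constants. *)
Definition is_connection (nabla : V -> V -> V) :=
  [/\ forall (f : C) X X' Y,
        nabla (f *: X + X') Y = f *: nabla X Y + nabla X' Y,
      forall X Y Y', nabla X (Y + Y') = nabla X Y + nabla X Y' &
      forall (f : C) X Y, nabla X (f *: Y) = X f *: Y + f *: nabla X Y].

Definition torsion (nabla : V -> V -> V) X Y : V :=
  nabla X Y - nabla Y X - bracket X Y.

Definition cov02 (nabla : V -> V -> V) (B : V -> V -> C) (X Y Z : V) : C :=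
  X (B Y Z) - B (nabla X Y) Z - B Y (nabla X Z).

Definition cov11 (nabla : V -> V -> V) (A : V -> V) (X Y : V) : V :=
  nabla X (A Y) - A (nabla X Y).

Definition parallel02 (nabla : V -> V -> V) (B : V -> V -> C) :=
  forall X Y Z, cov02 nabla B X Y Z = 0.

Definition parallel11 (nabla : V -> V -> V) (A : V -> V) :=
  forall X Y, cov11 nabla A X Y = 0.

Definition levi_civita (g : V -> V -> C) (nabla : V -> V -> V) :=
  [/\ is_connection nabla, forall X Y, torsion nabla X Y = 0 &
      parallel02 nabla g].

Definition ext_d (F : V -> V -> C) (X Y Z : V) : C :=
  X (F Y Z) + Y (F Z X) + Z (F X Y)
  - F (bracket X Y) Z - F (bracket Y Z) X - F (bracket Z X) Y.

Definition is_torsion_tensor (T : V -> V -> V) :=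
  is_tensor12 T /\ forall X Y, T X Y = - T Y X.

Definition lower (g : V -> V -> C) (T : V -> V -> V) (X Y Z : V) : C :=
  g (T X Y) Z.

(* Condition (1) on T, with t the (0,3)-version of T. *)
Definition torsion_condition (G : V -> V -> C) (A : V -> V)
    (nablag : V -> V -> V) (T : V -> V -> V) :=
  let t := lower (sym_part G) T in
  forall X Y Z,
    cov02 nablag (skew_part G) X Y Z =
      - (2^-1 *: (t X Y (A Z) + t Z X (A Y)))
      - 2^-1 *: (t (A Z) X Y + t (A Z) Y X + t X (A Y) Z + t Z (A Y) X).

End Tensors.

(* Main.v *)
Require Import Defs.
From mathcomp Require Import all_boot all_order all_algebra.
From mathcomp Require Import all_classical all_reals all_analysis.
From mathcomp Require Import ring lra.

(** Part (a) is linear algebra: the covariant derivative commutes with taking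
    symmetric and skew-symmetric parts, and for a metric connection
    (nabla_X F)(Y, Z) = g((nabla_X A) Y, Z), so that F and A are parallel
    together by nondegeneracy ([parallel_parts], [parallel_skew_endo]).

    For part (b), compare a metric connection with torsion T to the Levi-Civita
    connection. As in the Koszul formula, being metric and having torsion T
    determine the difference: it is the contorsion of T ([koszul_contorsion]).
    Substituting this difference in nabla F gives the covariant derivative of F
    for the Levi-Civita connection minus the right-hand side of the condition on
    T ([cov_skew_contorsion]); so this condition says exactly that the
    connection with contorsion given by T preserves F. The formula for dF is the
    cyclic sum of nabla F = 0.

    The converse has to produce a vector field nabla_X Y from the function
    Z |-> g(nabla_X Y, Z). The term g(T(Z, X), Y) is not visibly of the form
    g(W, Z), so one needs that every one-form is g(W, -) for some vector field W
    ([sharp]). As vector fields are derivations of the algebra of smooth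
    functions, this rests on the theorem that derivations are combinations of
    partial derivatives. In a chart, Hadamard's lemma ([hadamard]) writes
    f - f(p) as a sum of products of x_i - x_i(p) and smooth functions, hence
    X f (p) = sum_i (X x_i)(p) df/dx_i(p). Multiplying by powers of a bump
    function chi makes everything global: there are vector fields E_i and
    one-forms xi_i with chi^3 X = sum_i xi_i(X) E_i ([frame_decomposition]).
    Cramer's rule for the Gram matrix of the E_i then solves g(W, -) = h w for
    some function h with h(p) <> 0 ([local_sharp]), and the quotients W / h do
    not depend on the choices and glue, without any partition of unity.

    Hadamard's lemma is proved by moving from one point to the other one
    coordinate at a time and integrating a partial derivative along each edge of
    this staircase; the integrals are smooth by differentiation under the
    integral sign ([Ck_box_integral]). It also yields the chain rule for maps of
    class C^k ([Ck_comp]), hence the independence of smoothness from the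
    chart. *)

Set Implicit Arguments.
Unset Strict Implicit.
Unset Printing Implicit Defensive.
Import Order.TTheory GRing.Theory Num.Theory.
Import numFieldNormedType.Exports.
Local Open Scope classical_set_scope.
Local Open Scope ring_scope.

(** * Functions of class C^k *)

Section CkTheory.
Variables (R : realType) (n : nat).
Implicit Types (U V : set 'rV[R]_n) (f g : 'rV[R]_n -> R).

Lemma sub_Ck k U V f : V `<=` U -> Ck k U f -> Ck k V f.
Proof.
move=> VU; elim: k f => [|k IHk] f.
  by move=> cf x /[!inE] /VU Ux; apply: cf; rewrite inE.
move=> [cf df]; split.
  by move=> x /[!inE] /VU Ux; apply: cf; rewrite inE.
move=> i; have [df1 df2] := df i; split; last exact: IHk.
by move=> x /[!inE] /VU Ux; apply: df1; rewrite inE.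
Qed.

Lemma Ck_local k U f :
  (forall x, U x -> exists2 V, V x & Ck k V f) -> Ck k U f.
Proof.
elim: k f => [|k IHk] f loc.
  move=> x /[!inE] /loc[V Vx cf]; apply: cf; rewrite inE //.
split.
  move=> x /[!inE] /loc[V Vx [cf _]]; apply: cf; rewrite inE //.
move=> i; split.
  move=> x /[!inE] /loc[V Vx [_ /(_ i)[df _]]]; apply: df; rewrite inE //.
by apply: IHk => x /loc[V Vx [_ /(_ i)[_ df]]]; exists V.
Qed.

Lemma Ck_sum k U (I : Type) (s : seq I) (F : I -> 'rV[R]_n -> R) :
  open U -> (forall i, Ck k U (F i)) -> Ck k U (fun x => \sum_(i <- s) F i x).
Proof.
move=> oU CF; elim: s => [|i s IHs].
  by apply: (eq_Ck oU _ (Ck_cst k 0 oU)) => x _; rewrite big_nil.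
by apply: (eq_Ck oU _ (CkD oU (CF i) IHs)) => x _; rewrite big_cons.
Qed.

Lemma Ck_prod k U (I : Type) (s : seq I) (F : I -> 'rV[R]_n -> R) :
  open U -> (forall i, Ck k U (F i)) -> Ck k U (fun x => \prod_(i <- s) F i x).
Proof.
move=> oU CF; elim: s => [|i s IHs].
  by apply: (eq_Ck oU _ (Ck_cst k 1 oU)) => x _; rewrite big_nil.
by apply: (eq_Ck oU _ (CkM oU (CF i) IHs)) => x _; rewrite big_cons.
Qed.

Lemma is_derive_coord (i j : 'I_n) (x : 'rV[R]_n) :
  is_derive x (delta_mx 0 i) (fun x : 'rV[R]_n => x 0 j) (i == j)%:R.
Proof.
have dx := @is_derive_id R 'rV[R]_n x (delta_mx 0 i).
have dd := @ex_derive _ _ _ _ _ _ _ dx.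
apply: DeriveDef; first exact: (derivable_mxP _ _ _).1 dd _ _.
have /matrixP/(_ 0 j) := derive_mx dd.
by rewrite derive_id mxE => dxj; rewrite mxE in dxj; rewrite -dxj eqxx eq_sym.
Qed.

Lemma Ck_coord k U (j : 'I_n) : open U -> Ck k U (fun x : 'rV[R]_n => x 0 j).
Proof.
move=> oU; have cc : {in U, continuous (fun x : 'rV[R]_n => x 0 j)}.
  by move=> x _; exact: coord_continuous.
case: k => [|k]; first exact: cc.
split => // i; have dc := is_derive_coord i j.
split => [x _|]; first exact: (@ex_derive _ _ _ _ _ _ _ (dc x)).
apply: (eq_Ck oU _ (Ck_cst k ((i == j)%:R : R) oU)) => x _.
by rewrite (@derive_val _ _ _ _ _ _ _ (dc x)).
Qed.

Lemma CkV k U f : open U -> {in U, forall x, f x != 0} -> Ck k U f ->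
  Ck k U (fun x => (f x)^-1).
Proof.
move=> oU f0; elim: k f f0 => [|k IHk] f f0 Cf.
  by move=> x Ux; exact: (cvgV (f0 _ Ux) (Cf _ Ux)).
have [cf df] := Cf; split.
  by move=> x Ux; exact: (cvgV (f0 _ Ux) (cf _ Ux)).
move=> i; have [df1 df2] := df i; split.
  by move=> x Ux; apply: derivableV; [exact: f0|exact: df1].
have Cfv := IHk _ f0 (CkS Cf).
have := CkM oU (Ck_cst k (-1) oU) (CkM oU (CkM oU Cfv Cfv) df2).
apply: eq_Ck => // x Ux /=.
rewrite deriveV; [|exact: f0|exact: df1].
by rewrite expr2 invfM scaleNr mulN1r.
Qed.

End CkTheory.

(** * Directional derivatives *)

Section LineDerivative.
Variables (R : realType) (V : normedModType R).

(** Reduces directional derivatives to functions of one real variable, where the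
    chain rule applies. *)
Lemma is_derive_lineP (f : V -> R) (x v : V) (d : R) :
  is_derive x v f d <-> is_derive (0 : R) 1 (fun h : R => f (h *: v + x)) d.
Proof.
have E : 'D_v f x = 'D_1 (fun h : R => f (h *: v + x)) 0.
  rewrite /derive; set g1 := fun h => h^-1 *: _; set g2 := fun h => h^-1 *: _.
  suff -> : g1 = g2 by [].
  by rewrite funeqE /g1 /g2 => h /=; rewrite addr0 scale0r add0r [_%:A]mulr1.
split=> -[df <-]; apply: DeriveDef.
- exact: (derivable1P f x v).1 df.
- by rewrite E.
- exact: (derivable1P f x v).2 df.
- by rewrite E.
Qed.

Lemma is_derive_comp_line (g : R -> R) (f : V -> R) (x v : V) (a b : R) :
  is_derive (f x) 1 g a -> is_derive x v f b ->
  is_derive x v (g \o f) (a * b).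
Proof.
move=> dg /is_derive_lineP df; apply/is_derive_lineP.
by apply: (is_derive1_comp _ df); rewrite scale0r add0r.
Qed.

Lemma is_derive_affine_line (v : V -> R) (z e : V) (t b d : R) :
  is_derive z e v d ->
  is_derive t 1 (fun k => v (((k - t) * b) *: e + z)) (b * d).
Proof.
move=> /is_derive_lineP dv.
have dl : is_derive t 1 (fun k : R => (k - t) * b) b.
  have d1 : is_derive t 1 (fun k : R => k - t) 1.
    have := is_deriveB (@is_derive_id R R t 1) (is_derive_cst t t 1).
    by rewrite subr0.
  have := is_deriveM d1 (is_derive_cst b t 1).
  by rewrite /GRing.scale /= mulr0 add0r mulr1.
rewrite mulrC.
apply: (@is_derive1_comp _ (fun k => v (k *: e + z)) _ _ _ _ _ dl).
by rewrite subrr mul0r.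
Qed.

End LineDerivative.

(** * A smooth function with a half line of zeros *)

Section Bump.
Variable R : realType.

(** The factors x^-m make the family stable under differentiation, up to linear
    combinations, so that the smoothness of exp(-1/x) at 0 reduces to the single
    estimate [flat_le]. *)
Definition flat (m : nat) (x : R) : R :=
  if 0 < x then x ^- m * expR (- x^-1) else 0.

(** This is y^(m+1) / (m+1)! <= exp y for y = 1/x. *)
Lemma flat_le m (x : R) : `|flat m x| <= (m.+1)`!%:R * `|x|.
Proof.
rewrite /flat; case: ifP => x0; last by rewrite normr0 mulr_ge0.
rewrite ger0_norm ?mulr_ge0 ?expR_ge0 ?invr_ge0 ?exprn_ge0 ?(ltW x0)//.
rewrite gtr0_norm// expRN ler_pdivrMr ?expR_gt0//.
have ix : 0 <= x^-1 by rewrite invr_ge0 ltW.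
have := expR_ge1Dxn m ix => le1.
have : x^-1 ^+ m.+1 / (m.+1)`!%:R <= expR x^-1.
  by apply: le_trans le1; rewrite lerDr.
have f0 : 0 < (m.+1)`!%:R :> R by rewrite ltr0n fact_gt0.
rewrite ler_pdivrMr// => le2.
have : x * x^-1 ^+ m.+1 <= x * (expR x^-1 * (m.+1)`!%:R) by rewrite ler_pM2l.
have -> : x * x^-1 ^+ m.+1 = x ^- m.
  by rewrite exprS mulrA mulfV ?gt_eqF// mul1r exprVn.
by move=> /le_trans; apply; rewrite mulrA mulrC mulrA.
Qed.

Lemma flat_le0 m (x : R) : x <= 0 -> flat m x = 0.
Proof. by rewrite /flat leNgt => /negbTE->. Qed.

Lemma flat_gt0 (x : R) : 0 < x -> 0 < flat 0 x.
Proof. by move=> x0; rewrite /flat x0 mulr_gt0 ?expR_gt0// invr1. Qed.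

Lemma is_derive_flat_gt0 m (x : R) : 0 < x ->
  is_derive x 1 (flat m) (- m%:R * flat m.+1 x + flat m.+2 x).
Proof.
move=> x0; have xn0 : x != 0 by rewrite gt_eqF.
have nf : \near x, (x ^- m * expR (- x^-1)) = flat m x.
  have := open_nbhs_nbhs (conj (@open_gt R 0) (x0 : [set y | 0 < y] x)).
  by apply: filterS => y /= y0; rewrite /flat y0.
apply: (near_eq_is_derive nf).
have dX : is_derive x 1 (fun y : R => y ^- m) (- m%:R * x ^- m.+1).
  have xm : x ^+ m != 0 by rewrite expf_neq0.
  apply: DeriveDef; first exact/derivableV/exprn_derivable.
  rewrite deriveV//; last exact: exprn_derivable.
  rewrite exp_derive /GRing.scale /= mulr1.
  case: m {nf} xm => [|m] xm; first by rewrite !mul0r mulr0 oppr0 mul0r.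
  have pm : x ^+ m != 0 by rewrite expf_neq0.
  rewrite !exprS; set p := x ^+ m in pm *.
  by field; rewrite pm xn0.
have dI : is_derive x 1 (fun y : R => - y^-1) (x ^- 2).
  have dV : is_derive x 1 (fun y : R => y^-1) (- x ^- 2).
    apply: DeriveDef; first by apply: derivableV.
    by rewrite deriveV// derive_id scaler1.
  by rewrite -[x ^- 2]opprK; exact: is_deriveN dV.
have dE : is_derive x 1 (fun y : R => expR (- y^-1)) (x ^- 2 * expR (- x^-1)).
  rewrite mulrC.
  exact: (@is_derive1_comp R expR (fun y => - y^-1) x _ _
    (is_derive_expR _) dI).
have dM := is_deriveM dX dE; apply: (is_derive_eq dM).
rewrite /flat x0 /GRing.scale /= (exprS x m.+1) (exprS x m).
have pm : x ^+ m != 0 by rewrite expf_neq0.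
set p := x ^+ m in pm *; set e := expR _.
by field; rewrite pm xn0.
Qed.

Lemma is_derive_flat m (x : R) :
  is_derive x 1 (flat m) (- m%:R * flat m.+1 x + flat m.+2 x).
Proof.
have [x0|x0|<-] := ltgtP 0 x; first exact: is_derive_flat_gt0.
  rewrite !flat_le0 ?(ltW x0)// mulr0 addr0.
  have nf : \near x, 0 = flat m x.
    have := open_nbhs_nbhs (conj (@open_lt R 0) (x0 : [set y | y < 0] x)).
    by apply: filterS => y /= y0; rewrite flat_le0// ltW.
  exact: (near_eq_is_derive nf).
rewrite !flat_le0// mulr0 addr0.
have cvq : h^-1 *: (flat m (h *: 1 + 0) - flat m 0) @[h --> 0^'] --> (0 : R).
  (* The difference quotient at 0 is the next function of the family. *)
  have e : \forall h \near (0 : R)^', flat m.+1 h =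
      h^-1 *: (flat m (h *: 1 + 0) - flat m 0).
    near=> h; have h0 : h != 0 by near: h; exact: nbhs_dnbhs_neq.
    rewrite (flat_le0 _ (lexx 0)) subr0 addr0 scaler1 /flat.
    by case: ifP => _; rewrite ?scaler0// exprS invfM -mulrA.
  apply: cvg_trans (near_eq_cvg e) _.
  apply/cvgrPdist_le => ep ep0; near=> h.
  rewrite sub0r normrN (le_trans (flat_le _ _))//.
  rewrite -ler_pdivlMl ?ltr0n ?fact_gt0//.
  near: h; apply: dnbhs0_le; by rewrite mulr_gt0// invr_gt0 ltr0n fact_gt0.
by apply: DeriveDef; [apply/cvg_ex; exists 0 | apply: cvg_lim].
Unshelve. all: by end_near. Qed.

(** The induction on k is for all m at once, since differentiating raises m. *)
Lemma Ck_flat n k (U : set 'rV[R]_n) (f : 'rV[R]_n -> R) m :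
  open U -> Ck k U f -> Ck k U (flat m \o f).
Proof.
move=> oU; elim: k f m => [|k IHk] f m Cf.
  move=> x Ux; apply: continuous_comp; first exact: Cf.
  have df := is_derive_flat m (f x).
  by apply/differentiable_continuous/derivable1_diffP; exact: ex_derive.
have [cf df] := Cf; split; first exact: Ck_continuous (IHk _ m (CkS Cf)).
move=> i; have [df1 df2] := df i.
have dfl x : x \in U -> is_derive x (delta_mx 0 i) (flat m \o f)
    ((- m%:R * flat m.+1 (f x) + flat m.+2 (f x)) * 'D_(delta_mx 0 i) f x).
  move=> Ux; apply: is_derive_comp_line; first exact: is_derive_flat.
  by apply: DeriveDef => //; exact: df1.
split => [x Ux|]; first exact: (@ex_derive _ _ _ _ _ _ _ (dfl x Ux)).
have Cm := CkM oU (Ck_cst k (- m%:R : R) oU) (IHk _ m.+1 (CkS Cf)).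
apply: (eq_Ck oU _ (CkM oU (CkD oU Cm (IHk _ m.+2 (CkS Cf))) df2)) => x Ux.
by rewrite (@derive_val _ _ _ _ _ _ _ (dfl x Ux)).
Qed.

End Bump.

(** * Integrals along paths in a box *)

Section CoordinatewiseLimits.
Variables (R : realType) (n : nat).

Lemma cvg_rV (T : Type) (F : set_system T) {FF : Filter F}
    (f : T -> 'rV[R]_n) (l : 'rV[R]_n) :
  (forall j, (fun t => f t 0 j) @ F --> l 0 j) -> f @ F --> l.
Proof.
move=> fl A [P lP PA]; rewrite /nbhs /=.
have : \forall t \near F, forall j, P 0 j (f t 0 j).
  by apply: filter_forall => j; apply: fl; exact: lP.
apply: filterS => t Pt; apply: PA => i j.
by rewrite (ord1 i); exact: Pt.
Qed.

End CoordinatewiseLimits.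

Section SegmentIntegral.
Variables (R : realType) (n : nat) (c a : 'rV[R]_n) (r : R).
Local Notation B := (ball c r : set 'rV[R]_n).
Local Notation mu := (@lebesgue_measure R).
Hypothesis aB : B a.
Variable s : 'I_n -> R -> R.
Hypothesis s_cont : forall j, continuous (s j).
Hypothesis s01 : forall j (t : R), 0 <= t <= 1 -> 0 <= s j t <= 1.

(** Every coordinate moves from its value in a to its value in x at its own
    speed. Balls are boxes for the sup norm, hence stable under such motions. *)
Definition box_path (t : R) (x : 'rV[R]_n) : 'rV[R]_n :=
  \row_j (a 0 j + s j t * (x 0 j - a 0 j)).

Lemma ball_rVP (x : 'rV[R]_n) : B x <-> 0 < r /\ forall j, `|c 0 j - x 0 j| < r.
Proof.
split=> [[r0 cx]|[r0 cx]]; first by split => // j; exact: cx.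
by split => // i j; rewrite (ord1 i); exact: cx.
Qed.

Lemma box_path_ball (t : R) x : 0 <= t <= 1 -> B x -> B (box_path t x).
Proof.
move=> t01 /ball_rVP[r0 cx]; apply/ball_rVP; split => // j; rewrite mxE.
have [_ /(_ j) ca] := (ball_rVP a).1 aB; have := cx j.
have /andP[s0 s1] := s01 j t01; move: ca; rewrite !ltr_norml.
move: (a 0 j) (x 0 j) (c 0 j) (s j t) s0 s1 => aj xj cj st s0 s1.
move=> /andP[a1 a2] /andP[x1 x2].
move: s0; rewrite le_eqVlt => /predU1P[<-|s0].
  by rewrite mul0r addr0 a1 a2.
have p1 : 0 < st * (r - (cj - xj)) by rewrite mulr_gt0// subr_gt0.
have p2 : 0 < st * (r + (cj - xj)) by rewrite mulr_gt0//; lra.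
have q1 : 0 <= (1 - st) * (r - (cj - aj)) by rewrite mulr_ge0//; lra.
have q2 : 0 <= (1 - st) * (r + (cj - aj)) by rewrite mulr_ge0//; lra.
apply/andP; split; lra.
Qed.

Lemma box_path_shift t x i h : box_path t (h *: delta_mx 0 i + x) =
  (h * s i t) *: delta_mx 0 i + box_path t x.
Proof.
apply/rowP => j; rewrite !mxE eqxx /=.
by case: eqP => [->|_]; rewrite ?mulr1n ?mulr0n; ring.
Qed.

Lemma box_path_cvg (t : R) x :
  box_path p.1 p.2 @[p --> (t, x)] --> box_path t x.
Proof.
apply: cvg_rV => j; rewrite mxE; under eq_fun do rewrite mxE.
apply: cvgD; first exact: cvg_cst.
apply: cvgM.
  apply: (cvg_comp (fun p : R * 'rV[R]_n => p.1) (s j)); first exact: cvg_fst.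
  exact: s_cont.
apply: cvgB; last exact: cvg_cst.
apply: (cvg_comp (fun p : R * 'rV[R]_n => p.2) (fun y : 'rV[R]_n => y 0 j)).
  exact: cvg_snd.
exact: coord_continuous.
Qed.

(** The tube lemma: as [0, 1] is compact, continuity in (t, x) is uniform in
    t. *)
Lemma box_path_tube (v : 'rV[R]_n -> R) x e : {in B, continuous v} -> B x ->
  0 < e -> \forall y \near x, forall t, 0 <= t <= 1 ->
    `|v (box_path t y) - v (box_path t x)| < e.
Proof.
move=> cv Bx e0.
have e2 : 0 < e / 2 by rewrite divr_gt0.
have near_tx (t : R) : 0 <= t <= 1 -> \forall p \near (t, x),
    `|v (box_path p.1 p.2) - v (box_path p.1 x)| < e.
  move=> t01; have vx : {for box_path t x, continuous v}.
    by apply: cv; rewrite inE; exact: box_path_ball.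
  have vc := cvg_comp _ v (@box_path_cvg t x) vx.
  have near2 : \forall p \near (t, x),
      `|v (box_path t x) - v (box_path p.1 p.2)| < e / 2.
    exact: (cvgr_dist_lt _ _ vc _ e2).
  have cx : (p.1, x) @[p --> (t, x)] --> (t, x).
    apply: (@cvg_pair _ _ _ _ (nbhs t) (nbhs x) _ _ _
      (fun p : R * 'rV[R]_n => p.1) (fun=> x)); first exact: cvg_fst.
    exact: cvg_cst.
  have near1 : \forall p \near (t, x),
      `|v (box_path t x) - v (box_path p.1 x)| < e / 2.
    exact: (cvgr_dist_lt _ _ (cvg_comp _ _ cx vc) _ e2).
  apply: (filterS2 _ _ near1 near2) => -[t' y] /= h1 h2.
  rewrite (splitr e) distrC.
  by rewrite (le_lt_trans (ler_distD (v (box_path t x)) _ _))// ltrD// distrC.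
have /compact_near_coveringP cpt := @segment_compact R 0 1.
have : \forall y \near x, `[0, 1] `<=`
    (fun t => `|v (box_path t y) - v (box_path t x)| < e).
  apply: (cpt _ (nbhs x) (fun (y : 'rV[R]_n) (t : R) =>
    `|v (box_path t y) - v (box_path t x)| < e)) => t.
  by rewrite /= in_itv /= => /near_tx.
by apply: filterS => y Hy t t01; apply: Hy; rewrite /= in_itv.
Qed.

(** Differentiation in x_i brings out a factor s i t; the weight w collects
    these factors, so that the integrals form a family stable under partial
    derivatives. *)
Definition box_integral (w : R -> R) (v : 'rV[R]_n -> R) (x : 'rV[R]_n) : R :=
  \int[mu]_(t in `[0, 1]) (w t * v (box_path t x)).

Definition weight (w : R -> R) :=
  continuous w /\ forall t : R, 0 <= t <= 1 -> `|w t| <= 1.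

Lemma weight_speed w j : weight w -> weight (fun t => w t * s j t).
Proof.
move=> [cw w1]; split=> [t|t t01].
  by apply: continuousM; [exact: cw | exact: s_cont].
have /andP[s0 s1] := s01 j t01.
by rewrite normrM (ger0_norm s0) mulr_ile1// w1.
Qed.

Lemma box_path_continuous (v : 'rV[R]_n -> R) x (t : R) :
  {in B, continuous v} -> B x -> 0 <= t <= 1 ->
  {for t, continuous (fun t => v (box_path t x))}.
Proof.
move=> cv Bx t01; have vx : {for box_path t x, continuous v}.
  by apply: cv; rewrite inE; exact: box_path_ball.
have tx : (t', x) @[t' --> t] --> (t, x).
  apply: (@cvg_pair _ _ _ (nbhs t) (nbhs t) (nbhs x) _ _ _
      (fun t : R => t) (fun=> x)); first exact: cvg_id.
  exact: cvg_cst.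
exact: (cvg_comp _ _ tx (cvg_comp _ v (@box_path_cvg t x) vx)).
Qed.

Lemma box_integrable w (v : 'rV[R]_n -> R) x : weight w ->
  {in B, continuous v} -> B x ->
  mu.-integrable `[0, 1] (EFin \o (fun t => w t * v (box_path t x))).
Proof.
move=> [cw _] cv Bx; apply: continuous_compact_integrable.
  exact: segment_compact.
apply: continuous_in_subspaceT => t; rewrite inE /= in_itv /= => t01.
by apply: continuousM; [exact: cw | exact: box_path_continuous].
Qed.

Lemma normr_Rintegral01_le (f : R -> R) e :
  mu.-integrable `[0, 1] (EFin \o f) ->
  (forall t : R, 0 <= t <= 1 -> `|f t| <= e) ->
  `|\int[mu]_(t in `[0, 1]) f t| <= e.
Proof.
move=> intf fe; apply: (le_trans (le_normr_Rintegral _ intf)) => //.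
have -> : e = \int[mu]_(t in `[0, 1]) e.
  rewrite Rintegral_cst//= lebesgue_measure_itv/= lte_fin ltr01.
  by rewrite sube0 /= mulr1.
apply: le_Rintegral => //.
- exact: integrable_norm.
- apply: continuous_compact_integrable; first exact: segment_compact.
  by apply: continuous_subspaceT => t; exact: cvg_cst.
Qed.

Lemma box_integral_continuous w (v : 'rV[R]_n -> R) :
  weight w -> {in B, continuous v} ->
  {in B, continuous (box_integral w v)}.
Proof.
move=> ww cv; suff cI (x : 'rV[R]_n) : B x ->
    box_integral w v y @[y --> x] --> box_integral w v x.
  by move=> x /[!inE]; exact: cI.
move=> Bx; apply/(@cvgrPdist_le _ _ _ _ (nbhs_filter x)) => e e0.
have nB : \forall y \near x, B y.
  by apply: open_nbhs_nbhs; split => //; exact: ball_open.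
near=> y.
have By : B y by near: y.
rewrite /box_integral -RintegralB//; try exact: box_integrable.
apply: normr_Rintegral01_le => [|t t01].
  exact: (integrableB _ (box_integrable ww cv Bx) (box_integrable ww cv By)).
rewrite -mulrBr normrM -[e]mul1r ler_pM//; first exact: ww.2.
rewrite distrC ltW//; move: t t01; near: y.
exact: box_path_tube.
Unshelve. all: by end_near. Qed.

Lemma is_derive_box_path (v : 'rV[R]_n -> R) x i (t h : R) :
  {in B, forall x, derivable v x (delta_mx 0 i)} -> 0 <= t <= 1 ->
  B (h *: delta_mx 0 i + x) ->
  is_derive h 1 (fun k => v (box_path t (k *: delta_mx 0 i + x)))
    (s i t * 'D_(delta_mx 0 i) v (box_path t (h *: delta_mx 0 i + x))).
Proof.
move=> dv t01 Bh; set e := delta_mx 0 i; set z := box_path t (h *: e + x).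
have dz : is_derive z e v ('D_e v z).
  by apply: DeriveDef => //; apply: dv; rewrite inE; exact: box_path_ball.
have E : (fun k => v (box_path t (k *: e + x))) =
    (fun k : R => v (((k - h) * s i t) *: e + z)).
  apply/funext => k; congr (v _); rewrite -box_path_shift addrA -scalerDl.
  by rewrite subrK.
by rewrite E; exact: is_derive_affine_line.
Qed.

(** Differentiation under the integral sign; the required bound on the
    derivative of the integrand, uniform in t and for points near x, comes from
    the tube lemma. *)
Lemma is_derive_box_integral w (v : 'rV[R]_n -> R) x i : weight w ->
  {in B, continuous v} ->
  {in B, forall x, derivable v x (delta_mx 0 i)} ->
  {in B, continuous ('D_(delta_mx 0 i) v)} -> B x ->
  is_derive x (delta_mx 0 i) (box_integral w v)
    (box_integral (fun t => w t * s i t) ('D_(delta_mx 0 i) v) x).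
Proof.
move=> ww cv dv cdv Bx; apply/is_derive_lineP.
set e := delta_mx 0 i; set dvi := 'D_e v.
have wsi := weight_speed i ww.
pose f (h t : R) := w t * v (box_path t (h *: e + x)).
have [tm tm01 maxd] : exists2 tm : R, 0 <= tm <= 1 &
    forall t : R, 0 <= t <= 1 ->
    `|dvi (box_path t x)| <= `|dvi (box_path tm x)|.
  have [|tm] := @EVT_max R (fun t => `|dvi (box_path t x)|) 0 1 ler01.
    apply: continuous_in_subspaceT => t; rewrite inE /= in_itv /= => t01.
    by apply: cvg_norm; exact: box_path_continuous.
  rewrite in_itv /= => tm01 maxd.
  by exists tm.
(* The maximum along the path, plus a margin to cover the points near x. *)
pose K := `|dvi (box_path tm x)| + 1.
have xe : (h *: e + x) @[h --> (0 : R)] --> x.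
  have : (h *: e + x) @[h --> (0 : R)] --> 0 *: e + x.
    by apply: cvgD; [apply: cvgZr_tmp; exact: cvg_id | exact: cvg_cst].
  by rewrite scale0r add0r.
have [d d0 dP] : exists2 d : R, 0 < d & forall h : R, `|h| < d ->
    B (h *: e + x) /\ forall t : R, 0 <= t <= 1 ->
      `|dvi (box_path t (h *: e + x))| <= K.
  have nB : \forall y \near x, B y.
    by apply: open_nbhs_nbhs; split => //; exact: ball_open.
  have nK : \forall y \near x, forall t : R, 0 <= t <= 1 ->
      `|dvi (box_path t y)| <= K.
    apply: filterS (box_path_tube cdv Bx ltr01) => y yx t t01.
    have := ler_normD (dvi (box_path t y) - dvi (box_path t x))
      (dvi (box_path t x)).
    rewrite subrK => /le_trans; apply.
    by rewrite addrC lerD// ?maxd// ltW// yx.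
  have : \forall h \near (0 : R), B (h *: e + x) /\ forall t : R, 0 <= t <= 1 ->
      `|dvi (box_path t (h *: e + x))| <= K.
    exact: xe (filterI nB nK).
  move=> /nbhs_ballP[d /= d0 dP].
  by exists d => // h hd; apply: dP; rewrite /ball /= sub0r normrN.
have df (h t : R) : `|h| < d -> 0 <= t <= 1 ->
    is_derive h 1 (f^~ t) (w t * s i t * dvi (box_path t (h *: e + x))).
  move=> hd t01; have dp := is_derive_box_path dv t01 (dP h hd).1.
  have dM := is_deriveM (is_derive_cst (w t) h 1) dp.
  by apply: (is_derive_eq dM); rewrite /GRing.scale /= mulr0 addr0 mulrA.
have Ih (h : R) : (`]- d, d[%classic : set R) h -> `|h| < d.
  by rewrite /= in_itv /= ltr_norml.
have I0 : (`]- d, d[%classic : set R) 0 by rewrite /= in_itv /= oppr_lt0 d0.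
have intf (h : R) : (`]- d, d[%classic : set R) h ->
    mu.-integrable `[0, 1] (EFin \o f h).
  by move=> /Ih hd; apply: box_integrable => //; exact: (dP h hd).1.
have derf (h t : R) :
    (`]- d, d[%classic : set R) h -> (`[0, 1]%classic : set R) t ->
    derivable (f^~ t) h 1.
  move=> /Ih hd; rewrite /= in_itv /= => t01.
  exact: (@ex_derive _ _ _ _ _ _ _ (df h t hd t01)).
have d1f (h t : R) : `|h| < d -> 0 <= t <= 1 -> partial1of2 f h t =
    w t * s i t * dvi (box_path t (h *: e + x)).
  move=> hd t01; rewrite partial1of2E.
  exact: (@derive_val _ _ _ _ _ _ _ (df h t hd t01)).
have G0 (t : R) : 0 <= K by rewrite addr_ge0.
have intG : mu.-integrable `[0, 1] (EFin \o (fun _ : R => K)).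
  apply: continuous_compact_integrable; first exact: segment_compact.
  by apply: continuous_subspaceT => t; exact: cvg_cst.
have Gub (h t : R) :
    (`]- d, d[%classic : set R) h -> (`[0, 1]%classic : set R) t ->
    `|partial1of2 f h t| <= K.
  move=> /Ih hd; rewrite /= in_itv /= => t01; rewrite d1f// normrM.
  rewrite -[K]mul1r ler_pM//; first exact: wsi.2.
  exact: (dP h hd).2.
have D := derivable_under_integral _ I0 intf derf G0 intG Gub.
have E := differentiation_under_integral _ I0 intf derf G0 intG Gub.
apply: DeriveDef; first exact: D.
rewrite -derive1E; apply: (eq_trans (E _)) => //; apply: eq_Rintegral => t.
rewrite inE /= in_itv /= => t01.
by rewrite d1f ?normr0// scale0r add0r.
Qed.

Lemma Ck_box_integral k w (v : 'rV[R]_n -> R) : weight w -> Ck k B v ->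
  Ck k B (box_integral w v).
Proof.
have [r0 _] := (ball_rVP a).1 aB.
have oB : open B by exact: ball_open.
elim: k w v => [|k IHk] w v ww; first exact: box_integral_continuous.
move=> Cv; have [cv dv] := Cv; split; first exact: box_integral_continuous.
move=> i; have [dv1 dv2] := dv i.
have dI x : x \in B -> is_derive x (delta_mx 0 i) (box_integral w v)
    (box_integral (fun t => w t * s i t) ('D_(delta_mx 0 i) v) x).
  rewrite inE => Bx; apply: is_derive_box_integral => //.
  exact: Ck_continuous dv2.
split => [x Bx|]; first exact: (@ex_derive _ _ _ _ _ _ _ (dI x Bx)).
apply: (eq_Ck oB _ (IHk _ _ (weight_speed i ww) dv2)) => x Bx.
by rewrite (@derive_val _ _ _ _ _ _ _ (dI x Bx)).
Qed.

End SegmentIntegral.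

(** * Hadamard's lemma *)

Section Hadamard.
Variables (R : realType) (n : nat) (c a : 'rV[R]_n) (r : R).
Local Notation B := (ball c r : set 'rV[R]_n).
Local Notation mu := (@lebesgue_measure R).
Hypothesis aB : B a.

(** The segment path number i runs along the i-th edge of the staircase from a
    to x that changes the coordinates one at a time. *)
Definition staircase_speed (i j : 'I_n) (t : R) : R :=
  if (j < i)%N then 1 else if j == i then t else 0.

(** A smooth substitute for the difference quotient of u along the i-th edge. *)
Definition hadamard_coef (u : 'rV[R]_n -> R) (i : 'I_n) : 'rV[R]_n -> R :=
  box_integral a (staircase_speed i) (fun=> 1) ('D_(delta_mx 0 i) u).

Lemma staircase_cont i j : continuous (staircase_speed i j).
Proof.
rewrite /staircase_speed; case: (j < i)%N => [t|]; first exact: cvg_cst.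
by case: (j == i) => t; [exact: cvg_id | exact: cvg_cst].
Qed.

Lemma staircase01 i j (t : R) : 0 <= t <= 1 -> 0 <= staircase_speed i j t <= 1.
Proof.
by move=> t01; rewrite /staircase_speed; do 2?case: ifP => _ //;
  rewrite ?lexx ?ler01.
Qed.

Lemma weight1 : weight (fun=> 1 : R).
Proof. by split=> [t|t _]; [exact: cvg_cst | rewrite normr1]. Qed.

Lemma Ck_hadamard_coef k u i : Ck k.+1 B u -> Ck k B (hadamard_coef u i).
Proof.
move=> [_ /(_ i)[_ du]].
exact: (Ck_box_integral aB (@staircase_cont i) (@staircase01 i) weight1 du).
Qed.

Lemma hadamard_coef_base u i : hadamard_coef u i a = 'D_(delta_mx 0 i) u a.
Proof.
rewrite /hadamard_coef /box_integral.
rewrite (_ : (fun t : R => _) = fun=> 'D_(delta_mx 0 i) u a).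
  rewrite Rintegral_cst//= lebesgue_measure_itv/= lte_fin ltr01.
  by rewrite sube0 /= mulr1.
apply/funext => t; rewrite mul1r; congr ('D_ _ u _).
by apply/rowP => j; rewrite mxE subrr mulr0 addr0.
Qed.

Definition staircase_corner (x : 'rV[R]_n) (k : nat) : 'rV[R]_n :=
  \row_(j < n) if (j < k)%N then x 0 j else a 0 j.

Lemma hadamard_edge u x (i : 'I_n) : Ck 1 B u -> B x ->
  u (staircase_corner x i.+1) - u (staircase_corner x i) =
    (x 0 i - a 0 i) * hadamard_coef u i x.
Proof.
move=> [cu /(_ i)[du cdu]] Bx; set e : 'rV[R]_n := delta_mx 0 i.
pose p (t : R) := box_path a (staircase_speed i) t x.
have Bp (t : R) : 0 <= t <= 1 -> B (p t).
  by move=> t01; apply: box_path_ball => //; exact: staircase01.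
have pE (t k : R) : p k = ((k - t) * (x 0 i - a 0 i)) *: e + p t.
  apply/rowP => j; rewrite !mxE /staircase_speed eqxx /=.
  case: ltnP => [ji|_]; last case: eqVneq => [->|_].
  - by rewrite (_ : (j == i) = false) ?mulr0 ?add0r//; apply: ltn_eqF.
  - by rewrite mulr1n; ring.
  - by rewrite mulr0n; ring.
have dp (t : R) : 0 <= t <= 1 ->
    is_derive t 1 (u \o p) ((x 0 i - a 0 i) * 'D_e u (p t)).
  move=> t01; rewrite (_ : u \o p = fun k =>
    u (((k - t) * (x 0 i - a 0 i)) *: e + p t)); last first.
    by apply/funext => k /=; rewrite (pE t k).
  apply: is_derive_affine_line; apply: DeriveDef => //.
  by apply: du; rewrite inE; exact: Bp.
have cp (t : R) : 0 <= t <= 1 -> {for t, continuous (u \o p)}.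
  by move=> /dp dpt; apply/differentiable_continuous/derivable1_diffP/ex_derive.
have cD (t : R) : 0 <= t <= 1 -> {for t, continuous (fun t => 'D_e u (p t))}.
  move=> t01.
  exact: (box_path_continuous aB (@staircase_cont i) (@staircase01 i)
    cdu Bx t01).
have p0 : p 0 = staircase_corner x i.
  apply/rowP => j; rewrite !mxE /staircase_speed.
  case: ifP => _; first by rewrite mul1r addrC subrK.
  by case: ifP; rewrite mul0r addr0.
have p1 : p 1 = staircase_corner x i.+1.
  apply/rowP => j; rewrite !mxE /staircase_speed ltnS -val_eqE /=.
  by case: (ltngtP j i) => _; rewrite ?mul0r ?addr0// mul1r addrC subrK.
have FTC := @continuous_FTC2 R (fun t => (x 0 i - a 0 i) * 'D_e u (p t))
  (u \o p) 0 1 ltr01.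
have intD : mu.-integrable `[0, 1] (EFin \o (fun t => 'D_e u (p t))).
  apply: continuous_compact_integrable; first exact: segment_compact.
  by apply: continuous_in_subspaceT => t; rewrite inE /= in_itv /= => /cD.
rewrite /hadamard_coef /box_integral -p0 -p1.
under eq_Rintegral do rewrite mul1r.
rewrite -RintegralZl// /Rintegral FTC//.
- apply: continuous_in_subspaceT => t; rewrite inE /= in_itv /= => t01.
  by apply: cvgM; [exact: cvg_cst | exact: cD].
- split.
  + move=> t; rewrite in_itv /= => /andP[t0 t1].
    have t01 : 0 <= t <= 1 by rewrite !ltW.
    exact: (@ex_derive _ _ _ _ _ _ _ (dp t t01)).
  + by apply: cvg_at_right_filter; apply: cp; rewrite lexx ler01.
  + by apply: cvg_at_left_filter; apply: cp; rewrite lexx ler01.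
- move=> t; rewrite in_itv /= => /andP[t0 t1].
  have t01 : 0 <= t <= 1 by rewrite !ltW.
  by rewrite derive1E (@derive_val _ _ _ _ _ _ _ (dp t t01)).
Qed.

(** Telescoping along the staircase: only one coordinate changes on each edge,
    so the fundamental theorem of calculus in one variable is enough. *)
Lemma hadamard u x : Ck 1 B u -> B x ->
  u x = u a + \sum_i (x 0 i - a 0 i) * hadamard_coef u i x.
Proof.
move=> Cu Bx.
transitivity (u a + \sum_(0 <= i < n)
    (u (staircase_corner x i.+1) - u (staircase_corner x i))).
  rewrite telescope_sumr// addrC.
  rewrite (_ : staircase_corner x 0 = a) ?subrK; last first.
    by apply/rowP => j; rewrite mxE.
  by congr u; apply/rowP => j; rewrite mxE ltn_ord.
rewrite big_mkord; congr (_ + _).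
by apply: eq_bigr => i _; exact: hadamard_edge.
Qed.

End Hadamard.

(** * The chain rule *)

Section ChainRule.
Variables (R : realType).

(** The difference quotient of the product at 0 is the one of p multiplied by
    q. *)
Lemma is_derive_vanishing_mul (p q : R -> R) (d : R) :
  is_derive (0 : R) 1 p d -> p 0 = 0 -> {for (0 : R), continuous q} ->
  is_derive (0 : R) 1 (fun h => p h * q h) (d * q 0).
Proof.
move=> [dp pd] p0 cq; rewrite -pd.
have cd : h^-1 *: (p (h *: 1 + 0) - p 0) @[h --> (0 : R)^'] --> 'D_1 p 0.
  exact: dp.
have cpq : h^-1 *: (p (h *: 1 + 0) * q (h *: 1 + 0) - p 0 * q 0)
    @[h --> (0 : R)^'] --> 'D_1 p 0 * q 0.
  rewrite (_ : (fun h : R => _) =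
    (fun h => h^-1 *: (p (h *: 1 + 0) - p 0) * q h)); last first.
    by apply/funext => h; rewrite p0 mul0r !subr0 addr0 scaler1 scalerAl.
  by apply: cvgM => //; apply: cvg_within_filter; exact: cq.
apply: DeriveDef; last exact: cvg_lim cpq.
by apply/cvg_ex; exists ('D_1 p 0 * q 0).
Qed.

(** By Hadamard's lemma at phi x, the function u \o phi is a constant plus a
    sum of products of a differentiable factor that vanishes at x and a
    continuous factor. *)
Lemma is_derive_chain m (V : normedModType R) (W : set 'rV[R]_m)
    (u : 'rV[R]_m -> R) (phi : V -> 'rV[R]_m) (x v : V) (d : 'I_m -> R) :
  open W -> Ck 1 W u -> W (phi x) ->
  (forall j, is_derive x v (fun y => phi y 0 j) (d j)) ->
  is_derive x v (u \o phi) (\sum_j d j * 'D_(delta_mx 0 j) u (phi x)).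
Proof.
move=> oW Cu Wx dphi; apply/is_derive_lineP.
pose f (h : R) := phi (h *: v + x).
have df j : is_derive (0 : R) 1 (fun h => f h 0 j) (d j).
  exact: (is_derive_lineP (fun y => phi y 0 j) x v (d j)).1 (dphi j).
have f0 : f 0 = phi x by rewrite /f scale0r add0r.
have cf : {for (0 : R), continuous f}.
  apply: cvg_rV => j; have dfj := df j.
  apply: differentiable_continuous; apply/derivable1_diffP.
  exact: (@ex_derive _ _ _ _ _ _ _ dfj).
have /nbhs_ballP[r /= r0 BW] : nbhs (phi x) W by exact: open_nbhs_nbhs.
have Bx : (ball (phi x) r : set 'rV[R]_m) (phi x) by exact: ballxx.
have oB : open (ball (phi x) r : set 'rV[R]_m) by exact: ball_open.
have CuB := sub_Ck BW Cu.
pose q j (h : R) := hadamard_coef (phi x) u j (f h).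
have cq j : {for (0 : R), continuous (q j)}.
  apply: continuous_comp; first exact: cf.
  by apply: (Ck_hadamard_coef Bx j CuB); rewrite inE f0.
have dpq j : is_derive (0 : R) 1 (fun h => (f h 0 j - phi x 0 j) * q j h)
    (d j * 'D_(delta_mx 0 j) u (phi x)).
  have -> : 'D_(delta_mx 0 j) u (phi x) = q j 0.
    by rewrite /q f0 hadamard_coef_base.
  apply: (@is_derive_vanishing_mul (fun h => f h 0 j - phi x 0 j) (q j) (d j)).
  - have dfj := df j.
    have := is_deriveB dfj (is_derive_cst (phi x 0 j) (0 : R) 1).
    by rewrite subr0.
  - by rewrite f0 subrr.
  - exact: cq.
have dS := is_deriveD (is_derive_cst (u (phi x)) (0 : R) 1) (is_derive_sum dpq).
rewrite add0r in dS; apply: (near_eq_is_derive _ dS).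
have : \forall h \near (0 : R), (ball (phi x) r : set 'rV[R]_m) (f h).
  by apply: cf; rewrite f0; apply: open_nbhs_nbhs.
apply: filterS => h Bh; rewrite [RHS](hadamard Bx CuB Bh) /=.
by rewrite fctE; congr (_ + _); rewrite fct_sumE.
Qed.

Lemma Ck_comp m n k (U : set 'rV[R]_n) (W : set 'rV[R]_m) (u : 'rV[R]_m -> R)
    (phi : 'rV[R]_n -> 'rV[R]_m) : open U -> open W ->
  (forall j, Ck k U (fun x => phi x 0 j)) -> (forall x, U x -> W (phi x)) ->
  Ck k W u -> Ck k U (u \o phi).
Proof.
move=> oU oW; elim: k u => [|k IHk] u Cphi UW Cu.
  suff cu (x : 'rV[R]_n) : U x -> {for x, continuous (u \o phi)}.
    by move=> x /[!inE]; exact: cu.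
  move=> Ux; apply: continuous_comp; last by apply: Cu; rewrite inE; exact: UW.
  apply: (@cvg_rV R m _ _ (nbhs_filter x)) => j.
  by apply: Cphi; rewrite inE.
have Cphik j := CkS (Cphi j).
split; first exact: Ck_continuous (IHk u Cphik UW (CkS Cu)).
have Cu1 : Ck 1 W u.
  have [cu du] := Cu; split => // j; have [du1 du2] := du j; split => //.
  exact: Ck_continuous du2.
move=> i; have dI x : x \in U -> is_derive x (delta_mx 0 i) (u \o phi)
    (\sum_j 'D_(delta_mx 0 i) (fun x => phi x 0 j) x *
       'D_(delta_mx 0 j) u (phi x)).
  rewrite inE => Ux; apply: (is_derive_chain oW) => //; first exact: UW.
  by move=> j; apply: DeriveDef => //; apply: ((Cphi j).2 i).1; rewrite inE.
split => [x Ux|]; first exact: (@ex_derive _ _ _ _ _ _ _ (dI x Ux)).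
have CS := @Ck_sum R n k U 'I_m (index_enum 'I_m)
  (fun j x => 'D_(delta_mx 0 i) (fun x => phi x 0 j) x *
       'D_(delta_mx 0 j) u (phi x)) oU.
apply: (eq_Ck oU _ (CS _)) => [x Ux|j].
  by rewrite (@derive_val _ _ _ _ _ _ _ (dI x Ux)).
apply: CkM => //; first exact: ((Cphi j).2 i).2.
exact: (IHk ('D_(delta_mx 0 j) u) Cphik UW (Cu.2 j).2).
Qed.

End ChainRule.

(** * Values of smooth functions and of vector fields *)

Section Evaluation.
Variables (R : realType) (n : nat) (M : manifold R n).
Local Notation C := (Coo M).
Local Notation V := (vector_field M).
Implicit Types (f g : C) (X Y : V) (p : M).

Lemma Coo0E p : (0 : C) p = 0. Proof. by []. Qed.
Lemma Coo1E p : (1 : C) p = 1. Proof. by []. Qed.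
Lemma CooDE f g p : (f + g) p = f p + g p. Proof. by []. Qed.
Lemma CooNE f p : (- f) p = - f p. Proof. by []. Qed.
Lemma CooME f g p : (f * g) p = f p * g p. Proof. by []. Qed.
Lemma CooZE (a : R) f p : (a *: f) p = a * f p. Proof. by []. Qed.
Lemma CooXE f k p : (f ^+ k) p = f p ^+ k.
Proof. by elim: k => // k IHk; rewrite !exprS -IHk. Qed.
Lemma Coo_sumE (I : Type) (r : seq I) (P : pred I) (F : I -> C) p :
  (\sum_(i <- r | P i) F i) p = \sum_(i <- r | P i) F i p.
Proof. by elim/big_rec2: _ => // i y f _ <-. Qed.
Definition CooE := (Coo0E, Coo1E, CooDE, CooNE, CooME, CooZE, CooXE, Coo_sumE).

Lemma vf0E f : (0 : V) f = 0. Proof. by []. Qed.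
Lemma vfDE X Y f : (X + Y) f = X f + Y f. Proof. by []. Qed.
Lemma vfNE X f : (- X) f = - X f. Proof. by []. Qed.
Lemma vfZE (h : C) X f : (h *: X) f = h * X f. Proof. by []. Qed.
Lemma vf_sumE (I : Type) (r : seq I) (P : pred I) (F : I -> V) f :
  (\sum_(i <- r | P i) F i) f = \sum_(i <- r | P i) F i f.
Proof. by elim/big_rec2: _ => // i y Z _ <-. Qed.
Definition vfE := (vf0E, vfDE, vfNE, vfZE, vf_sumE).

Lemma vf_ext X Y : (forall f p, X f p = Y f p) -> X = Y.
Proof.
by move=> XY; apply/val_inj/funext => f; apply: CooP => p; exact: XY.
Qed.

Lemma vfM X f g : X (f * g) = X f * g + f * X g.
Proof. exact: (vf_derivation X).2. Qed.

Lemma vfD X f g : X (f + g) = X f + X g.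
Proof. by have := (vf_derivation X).1 1 f g; rewrite !scale1r. Qed.

Lemma vf_0 X : X 0 = 0.
Proof. by apply: (@addrI _ (X 0)); rewrite -vfD !addr0. Qed.

Lemma vfZ X (a : R) f : X (a *: f) = a *: X f.
Proof. by have := (vf_derivation X).1 a f 0; rewrite vf_0 !addr0. Qed.

Lemma vfN X f : X (- f) = - X f.
Proof. by rewrite -scaleN1r vfZ scaleN1r. Qed.

Lemma vf_sum X (I : Type) (r : seq I) (P : pred I) (F : I -> C) :
  X (\sum_(i <- r | P i) F i) = \sum_(i <- r | P i) X (F i).
Proof.
by elim/big_rec2: _ => [|i y f _ <-]; [exact: vf_0 | rewrite vfD].
Qed.

Lemma vf_1 X : X 1 = 0.
Proof.
by apply: (@addrI _ (X 1)); rewrite addr0 -{3}[1]mulr1 vfM mulr1 mul1r.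
Qed.

End Evaluation.

(** * Extension by zero from a chart *)

Section ChartExtension.
Variables (R : realType) (n : nat) (M : manifold R n).

Lemma open_chart_preim (d : chart R n M) (A : set M) : open A ->
  open (chart_img d `&` chart_inv d @^-1` A).
Proof.
move=> oA; rewrite openE => x [dx Ax]; apply: filterI.
  by apply: open_nbhs_nbhs; split => //; exact: chart_img_open.
apply: (@chart_inv_cts _ _ _ d x); first by rewrite inE.
exact: open_nbhs_nbhs.
Qed.

Lemma open_subchart (c : chart R n M) (W : set 'rV[R]_n) : open W ->
  open (chart_dom c `&` chart_map c @^-1` W).
Proof.
move=> oW; rewrite openE => p [cp Wp]; apply: filterI.
  by apply: open_nbhs_nbhs; split => //; exact: chart_dom_open.
apply: (@chart_map_cts _ _ _ c p); first by rewrite inE.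
exact: open_nbhs_nbhs.
Qed.

Definition chart_extend (c : chart R n M) (W : set 'rV[R]_n) (u : 'rV[R]_n -> R)
    (p : M) : R :=
  if p \in chart_dom c `&` chart_map c @^-1` W then u (chart_map c p) else 0.

(** Compact subsets of the chart image are closed in M because M is Hausdorff,
    so the extension by zero vanishes on a neighbourhood of every point off the
    domain. *)
Lemma smooth_chart_extend (c : chart R n M) (W K : set 'rV[R]_n)
    (u : 'rV[R]_n -> R) :
  atlas c -> open W -> W `<=` chart_img c -> compact K -> K `<=` W ->
  smooth_on W u -> (forall x, W x -> ~ K x -> u x = 0) ->
  smooth (chart_extend c W u).
Proof.
move=> ac oW Wc cK KW su u0 d ad k; apply: Ck_local => x dx.
set D := chart_dom c `&` chart_map c @^-1` W.
have oD : open D by exact: open_subchart.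
have [Dx|nDx] := pselect (D (chart_inv d x)).
  exists (chart_img d `&` chart_inv d @^-1` D) => //.
  have oV := @open_chart_preim d _ oD.
  have phiV := Ck_comp (u := u)
    (phi := fun y => chart_map c (chart_inv d y)) oV oW.
  apply: (eq_Ck oV _ (phiV k _ _ (su k))) => [y|j|y [_ []//]].
    by rewrite inE => -[dy Dy]; rewrite /chart_extend /= mem_set.
  apply: sub_Ck (atlas_compatible ad ac j k) => y [dy [cy _]].
  by split.
pose K' := chart_inv c @` K.
have clK' : closed K'.
  apply: compact_closed; first exact: manifold_hausdorff.
  apply: continuous_compact cK; apply: continuous_in_subspaceT => y /[!inE] Ky.
  by apply: chart_inv_cts; rewrite inE; exact/Wc/KW.
have K'D : K' `<=` D.
  move=> _ [y Ky <-]; have cy := Wc _ (KW _ Ky); split.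
    by apply: set_mem; apply: chart_invP; rewrite inE.
  by rewrite /= chart_invK ?inE//; exact: KW.
exists (chart_img d `&` chart_inv d @^-1` (~` K')).
  by split => // /K'D.
have oV := @open_chart_preim d _ (closed_openC clK').
apply: (eq_Ck oV _ (Ck_cst k 0 oV)) => y; rewrite inE => -[dy nKy].
rewrite /= /chart_extend; case: ifPn => // /set_mem[cy Wy].
rewrite u0// => Ky; apply: nKy; exists (chart_map c (chart_inv d y)) => //.
by rewrite chart_mapK// inE.
Qed.

End ChartExtension.

(** * Derivations are combinations of partial derivatives *)

Section CoordinateFrame.
Variables (R : realType) (n : nat) (M : manifold R n) (c : chart R n M).
Variables (a : 'rV[R]_n) (r : R).
Hypotheses (ac : atlas c) (r0 : 0 < r).
Local Notation C := (Coo M).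
Local Notation V := (vector_field M).
Local Notation W := (ball a (r + r) : set 'rV[R]_n).
Local Notation D := (chart_dom c `&` chart_map c @^-1` W : set M).
Local Notation e i := (delta_mx 0 i : 'rV[R]_n).
Hypothesis Wc : W `<=` chart_img c.

Definition bump (x : 'rV[R]_n) : R :=
  \prod_j flat 0 (r ^+ 2 - (x 0 j - a 0 j) ^+ 2).

Lemma bump_center : 0 < bump a.
Proof.
by apply: prodr_gt0 => j _; rewrite subrr expr0n subr0 flat_gt0// exprn_gt0.
Qed.

Let W_open : open W.
Proof. by apply: ball_open; rewrite addr_gt0. Qed.

Lemma smooth_bump : smooth_on W bump.
Proof.
move=> k; apply: (Ck_prod _ (F := fun j x =>
  flat 0 (r ^+ 2 - (x 0 j - a 0 j) ^+ 2))) => // j.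
apply: (Ck_flat 0 W_open (f := fun x => r ^+ 2 - (x 0 j - a 0 j) ^+ 2)).
have Cj : Ck k W (fun x => x 0 j - a 0 j).
  exact: (CkD W_open (Ck_coord k j W_open) (Ck_cst k (- a 0 j) W_open)).
have Cj2 := CkM W_open (Ck_cst k (-1) W_open) (CkM W_open Cj Cj).
apply: (eq_Ck W_open _ (CkD W_open (Ck_cst k (r ^+ 2) W_open) Cj2)) => x _.
by rewrite /= mulN1r expr2.
Qed.

Lemma smooth_bump_extend (v : 'rV[R]_n -> R) : smooth_on W v ->
  chart_extend c W (bump \* v) \in smooth_pred (M := M).
Proof.
move=> sv; apply/asboolP.
pose A (j : 'I_n) : set R := `[a 0 j - r, a 0 j + r]%classic.
apply: (smooth_chart_extend
  (K := [set x : 'rV[R]_n | forall j, A j (x ord0 j)])).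
- exact: ac.
- exact: W_open.
- exact: Wc.
- by apply: rV_compact => j; exact: segment_compact.
- move=> x Ax; apply/ball_rVP; split=> [|j]; first by rewrite addr_gt0.
  have /andP[x1 x2] : a 0 j - r <= x 0 j <= a 0 j + r.
    by have := Ax j; rewrite /A /= in_itv.
  by move: r0 => ?; rewrite ltr_norml; apply/andP; split; lra.
- by move=> k; exact: (CkM W_open (smooth_bump k) (sv k)).
- move=> x _ nAx; have [j nAj] : exists j, ~ A j (x ord0 j).
    apply: contrapT => nex; apply: nAx => j.
    by apply: contrapT => nA; apply: nex; exists j.
  rewrite /= /bump (bigD1 j)//= flat_le0 ?mul0r//.
  have rx : r <= `|x 0 j - a 0 j|.
    rewrite leNgt; apply/negP; rewrite ltr_norml => /andP[x1 x2].
    apply: nAj; rewrite /A /= in_itv /=.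
    suff : a 0 j - r <= x 0 j <= a 0 j + r by [].
    by apply/andP; split; lra.
  by rewrite subr_le0 -[leRHS]real_normK ?num_real// ler_sqr ?nnegrE// ltW.
Qed.

Definition bump_extend (v : 'rV[R]_n -> R) (sv : smooth_on W v) : C :=
  MkCoo (smooth_bump_extend sv).

Lemma bump_extend_in (v : 'rV[R]_n -> R) (sv : smooth_on W v) p : D p ->
  bump_extend sv p = bump (chart_map c p) * v (chart_map c p).
Proof. by move=> Dp; rewrite /= /chart_extend mem_set. Qed.

Lemma bump_extend_out (v : 'rV[R]_n -> R) (sv : smooth_on W v) p : ~ D p ->
  bump_extend sv p = 0.
Proof. by move=> nDp; rewrite /= /chart_extend memNset. Qed.

Definition local_expr (f : C) : 'rV[R]_n -> R := f \o chart_inv c.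

Lemma smooth_local_expr f : smooth_on W (local_expr f).
Proof.
move=> k; apply: (sub_Ck Wc).
have /asboolP sf : Coo_fun f \in smooth_pred (M := M).
  exact: (valP f).
exact: sf ac k.
Qed.

Lemma smooth_partial i f : smooth_on W ('D_(e i) (local_expr f)).
Proof. by move=> k; exact: ((smooth_local_expr f k.+1).2 i).2. Qed.

Lemma derivable_local_expr i f x : W x -> derivable (local_expr f) x (e i).
Proof.
move=> Wx; apply: ((smooth_local_expr f 1).2 i).1; by rewrite inE.
Qed.

Definition bump_partial i (f : C) : C^o := bump_extend (smooth_partial i f).

Lemma bump_partial_derivation i : bump_partial i \in derivation_pred (M := M).
Proof.
apply/asboolP; split=> [b f g|f g]; apply: CooP => p;
  have [Dp|nDp] := pselect (D p).
- rewrite !CooE !(bump_extend_in _ Dp).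
  have -> : local_expr (b *: f + g) = b *: local_expr f + local_expr g by [].
  rewrite deriveD ?deriveZ; last first.
  + by apply: derivable_local_expr; case: Dp.
  + by apply: derivableZ; apply: derivable_local_expr; case: Dp.
  + by apply: derivable_local_expr; case: Dp.
  by rewrite /GRing.scale /=; ring.
- by rewrite !CooE !(bump_extend_out _ nDp) mulr0 addr0.
- rewrite !CooE !(bump_extend_in _ Dp).
  have -> : local_expr (f * g) = local_expr f * local_expr g by [].
  have [cp Wp] := Dp.
  rewrite deriveM; [|exact: derivable_local_expr..].
  have lK h : local_expr h (chart_map c p) = h p.
    by rewrite /local_expr /= chart_mapK// inE.
  by rewrite !lK /GRing.scale /=; ring.
- by rewrite !CooE !(bump_extend_out _ nDp) mul0r mulr0 addr0.
Qed.

Definition frame_field i : V := VectorField (bump_partial_derivation i).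

Lemma smooth_one : smooth_on W (fun=> 1 : R).
Proof. by move=> k; exact: Ck_cst. Qed.

Lemma smooth_coord j : smooth_on W (fun x => x 0 j).
Proof. by move=> k; exact: Ck_coord. Qed.

Definition cutoff : C := bump_extend smooth_one.
Definition cut_coord j : C := bump_extend (smooth_coord j).

(** Formally chi^2 dx_j, where chi is the cut-off function: the quotient rule
    for x_j = (chi x_j) / chi, cleared of denominators. *)
Definition frame_coef j (X : V) : C :=
  cutoff * X (cut_coord j) - cut_coord j * X cutoff.

Lemma frame_coef_local j (X : V) p :
  (forall f : C, X f p = 0) -> frame_coef j X p = 0.
Proof. by move=> X0; rewrite !CooE !X0 !mulr0 subr0. Qed.

Lemma frame_coef_linear j (f : C) (X Y : V) :
  frame_coef j (f *: X + Y) = f * frame_coef j X + frame_coef j Y.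
Proof. by apply: CooP => p; rewrite /frame_coef !vfE !CooE; ring. Qed.

Lemma frame_coef_frame i j : frame_coef j (frame_field i) =
  if i == j then cutoff ^+ 3 else 0.
Proof.
apply: CooP => p; have [Dp|nDp] := pselect (D p); last first.
  rewrite !CooE /cutoff /cut_coord !(bump_extend_out _ nDp) !mul0r subr0.
  by case: ifP => // _; rewrite CooXE (bump_extend_out _ nDp) expr0n.
have [cp Wp] := Dp.
set x := chart_map c p in Wp *.
have nW : \forall y \near x, W y by apply: open_nbhs_nbhs; split.
have locE (v : 'rV[R]_n -> R) (sv : smooth_on W v) :
    \forall y \near x, (bump \* v) y = local_expr (bump_extend sv) y.
  apply: filterS nW => y Wy.
  have Dy : D (chart_inv c y).
    split; first by apply: set_mem; apply: chart_invP; rewrite inE; exact: Wc.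
    by rewrite /= chart_invK// inE; exact: Wc.
  have iy : chart_map c (chart_inv c y) = y.
    by rewrite chart_invK// inE; exact: Wc.
  by rewrite [RHS](bump_extend_in sv Dy) iy.
have dE (v : 'rV[R]_n -> R) (sv : smooth_on W v) :
    frame_field i (bump_extend sv) p =
    bump x * (bump x * 'D_(e i) v x + v x * 'D_(e i) bump x).
  rewrite [LHS](bump_extend_in _ Dp); congr (_ * _).
  rewrite -(near_eq_derive _ (locE v sv)) deriveM//.
    by have := (smooth_bump 1).2 i => -[db _]; apply: db; rewrite inE.
  by have := (sv 1%N).2 i => -[dv _]; apply: dv; rewrite inE.
rewrite /frame_coef !CooE !dE derive_cst !(bump_extend_in _ Dp) -/x.
have -> : 'D_(e i) (fun x : 'rV[R]_n => x 0 j) x = (i == j)%:R.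
  have dc := is_derive_coord i j x.
  exact: (@derive_val _ _ _ _ _ _ _ dc).
case: eqP => _.
  by rewrite CooXE [cutoff p](bump_extend_in _ Dp) -/x mulr1n; ring.
by rewrite CooE mulr0n; ring.
Qed.

(** Hadamard's lemma writes f - f p as a sum of products of functions of which
    one factor vanishes at p, so that a derivation at p sees only the first
    order part of f. *)
Lemma frame_decomposition (X : V) :
  cutoff ^+ 3 *: X = \sum_i frame_coef i X *: frame_field i.
Proof.
apply: vf_ext => f p; rewrite vfE vf_sumE !CooE.
have [Dp|nDp] := pselect (D p); last first.
  rewrite [cutoff p](bump_extend_out _ nDp) expr0n mul0r.
  rewrite big1// => i _; rewrite vfE CooE.
  by rewrite [frame_field i f p](bump_extend_out _ nDp) mulr0.
have [cp Wp] := Dp; set x := chart_map c p in Wp *.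
have sh i : smooth_on W (hadamard_coef x (local_expr f) i).
  by move=> k; apply: Ck_hadamard_coef => //; exact: smooth_local_expr.
pose eta i : C := bump_extend (sh i).
have Hf : cutoff * cutoff * (f - f p *: (1 : C)) =
    \sum_i (cut_coord i - x 0 i *: cutoff) * eta i.
  apply: CooP => q; rewrite Coo_sumE.
  have [Dq|nDq] := pselect (D q); last first.
    rewrite !CooE [cutoff q](bump_extend_out _ nDq) mul0r mul0r big1// => i _.
    by rewrite CooE [eta i q](bump_extend_out _ nDq) mulr0.
  have [cq Wq] := Dq.
  have fq : f q = f p + \sum_i (chart_map c q 0 i - x 0 i) *
      hadamard_coef x (local_expr f) i (chart_map c q).
    have := hadamard Wp (smooth_local_expr f 1) Wq.
    by rewrite {1 2}/local_expr /= !chart_mapK ?inE.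
  rewrite !CooE [cutoff q](bump_extend_in _ Dq) fq !mulr1 addrAC subrr add0r.
  rewrite mulr_sumr.
  apply: eq_bigr => i _.
  rewrite !CooE [cutoff q](bump_extend_in _ Dq) [eta i q](bump_extend_in _ Dq).
  by rewrite [cut_coord i q](bump_extend_in _ Dq); ring.
have : X (cutoff * cutoff * (f - f p *: (1 : C))) p =
    X (\sum_i (cut_coord i - x 0 i *: cutoff) * eta i) p by rewrite Hf.
rewrite vf_sum Coo_sumE.
under eq_bigr => i _ do rewrite vfM !CooE vfD vfN vfZ !CooE.
rewrite !vfM !CooE vfD vfN vfZ vf_1 scaler0 subr0.
rewrite mulr1 subrr mulr0 add0r => XfE.
transitivity (cutoff p * (cutoff p * cutoff p * X f p)); first by ring.
rewrite XfE mulr_sumr.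
apply: eq_bigr => i _; rewrite vfE /frame_coef !CooE.
rewrite [frame_field i f p](bump_extend_in _ Dp) -/x.
rewrite [cutoff p](bump_extend_in _ Dp) [cut_coord i p](bump_extend_in _ Dp).
rewrite [eta i p](bump_extend_in _ Dp) -/x hadamard_coef_base.
ring.
Qed.

End CoordinateFrame.

(** * One-forms are represented by vector fields *)

Section LocalFrame.
Variables (R : realType) (n : nat) (M : manifold R n).
Local Notation C := (Coo M).
Local Notation V := (vector_field M).

(** A frame near p, stated for global vector fields: the factor rho clears the
    denominators that a basis of vector fields over a neighbourhood of p would
    need. *)
Theorem local_frame (p : M) :
  exists (rho : C) (E : 'I_n -> V) (xi : 'I_n -> V -> C),
  [/\ rho p != 0,
      forall X, rho *: X = \sum_i xi i X *: E i,
      forall i j, xi j (E i) = if i == j then rho else 0,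
      forall j (f : C) X Y, xi j (f *: X + Y) = f * xi j X + xi j Y &
      forall j (X : V) q, (forall f : C, X f q = 0) -> xi j X q = 0].
Proof.
have [c ac cp] := atlas_cover p; set a := chart_map c p.
have ca : chart_img c a by apply: set_mem; apply: chart_mapP; rewrite inE.
have /nbhs_ballP[d /= d0 dc] : nbhs a (chart_img c).
  by apply: open_nbhs_nbhs; split => //; exact: chart_img_open.
have r0 : 0 < d / 2 by rewrite divr_gt0.
have Wc : (ball a (d / 2 + d / 2) : set 'rV[R]_n) `<=` chart_img c.
  by rewrite -splitr.
exists (cutoff ac r0 Wc ^+ 3), (frame_field ac r0 Wc), (frame_coef ac r0 Wc).
split.
- rewrite CooXE expf_neq0// [cutoff _ _ _ p]bump_extend_in ?mulr1.
    by rewrite gt_eqF// bump_center.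
  by split => //=; apply: ballxx; rewrite addr_gt0.
- exact: frame_decomposition.
- exact: frame_coef_frame.
- exact: frame_coef_linear.
- by move=> j X q; exact: frame_coef_local.
Qed.

End LocalFrame.

Section Musical.
Variables (R : realType) (n : nat) (M : manifold R n).
Local Notation C := (Coo M).
Local Notation V := (vector_field M).

Definition is_tensor01 (w : V -> C) :=
  forall (f : C) X X', w (f *: X + X') = f * w X + w X'.

Section Tensor01.
Variable w : V -> C.
Hypothesis lw : is_tensor01 w.

Lemma tensor01_0 : w 0 = 0.
Proof.
have := lw 1 0 0; rewrite scale1r addr0 mul1r => w0.
by apply: (@addrI _ (w 0)); rewrite -w0 addr0.
Qed.

Lemma tensor01D X Y : w (X + Y) = w X + w Y.
Proof. by have := lw 1 X Y; rewrite scale1r mul1r. Qed.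

Lemma tensor01Z (f : C) X : w (f *: X) = f * w X.
Proof. by have := lw f X 0; rewrite tensor01_0 !addr0. Qed.

Lemma tensor01N X : w (- X) = - w X.
Proof. by rewrite -scaleN1r tensor01Z mulN1r. Qed.

Lemma tensor01_sum (I : Type) (r : seq I) (P : pred I) (F : I -> V) :
  w (\sum_(i <- r | P i) F i) = \sum_(i <- r | P i) w (F i).
Proof.
by elim/big_rec2: _ => [|i y X _ <-]; [exact: tensor01_0 | exact: tensor01D].
Qed.

End Tensor01.

Lemma Coo_prodE (I : Type) (r : seq I) (P : pred I) (F : I -> C) p :
  (\prod_(i <- r | P i) F i) p = \prod_(i <- r | P i) F i p.
Proof. by elim/big_rec2: _ => // i y f _ <-. Qed.

Lemma Coo_detE m (A : 'M[C]_m) p :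
  (\det A) p = \det (\matrix_(i, j) A i j p).
Proof.
rewrite /determinant Coo_sumE; apply: eq_bigr => s _.
rewrite !CooE Coo_prodE; congr (_ * _).
by apply: eq_bigr => i _; rewrite mxE.
Qed.

Variable g : V -> V -> C.
Hypotheses (tg : is_tensor02 g) (ng : Defs.nondegenerate g).

Lemma tensor02_left Y : is_tensor01 (fun X => g X Y).
Proof. by move=> f X X'; exact: tg.1. Qed.

Lemma tensor02_right X : is_tensor01 (g X).
Proof. by move=> f Y Y'; exact: tg.2. Qed.

Lemma metric_inj X X' : (forall Y, g X Y = g X' Y) -> X = X'.
Proof.
move=> XX'; apply/subr0_eq/vf_ext => f p; rewrite vf0E CooE; apply: ng => Y.
rewrite (tensor01D (tensor02_left Y)) (tensor01N (tensor02_left Y)).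
by rewrite XX' subrr.
Qed.

(** The adjugate of the Gram matrix of a frame raises indices up to the factor
    det(g_ij) rho. The determinant does not vanish at p: a vector in the kernel
    of the Gram matrix at p would give a combination of the frame that is
    g-orthogonal to everything at p. *)
Lemma local_sharp (w : V -> C) p : is_tensor01 w ->
  exists (h : C) (W : V), h p != 0 /\ forall Z, g W Z = h * w Z.
Proof.
move=> lw; have [rho [E [xi [rp dec xiE xilin xi0]]]] := local_frame p.
pose gram : 'M[C]_n := \matrix_(i, j) g (E i) (E j).
have expand (v : V -> C) Z : is_tensor01 v ->
    rho * v Z = \sum_i xi i Z * v (E i).
  move=> lv; rewrite -(tensor01Z lv) dec tensor01_sum//.
  by apply: eq_bigr => i _; rewrite tensor01Z.
have det_n0 : (\det gram) p != 0.
  rewrite Coo_detE; apply/negP => /det0P[v vn0 vg].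
  pose X := \sum_i (v 0 i *: (1 : C)) *: E i.
  have gX Y : g X Y p = 0.
    suff : (rho * g X Y) p = 0.
      by rewrite CooE => /eqP; rewrite mulf_eq0 (negPf rp) => /eqP.
    rewrite (expand _ _ (tensor02_right X)) Coo_sumE big1// => j _.
    rewrite CooE (tensor01_sum (tensor02_left (E j))) Coo_sumE.
    have := congr1 (fun u : 'rV[R]_n => u 0 j) vg; rewrite !mxE => vgj.
    apply/eqP; rewrite mulf_eq0; apply/orP; right; apply/eqP.
    rewrite -[RHS]vgj; apply: eq_bigr => i _.
    by rewrite (tensor01Z (tensor02_left (E j))) !mxE !CooE mulr1.
  have X0 := ng gX; case/eqP: vn0; apply/rowP => j; rewrite mxE.
  have := xi0 j _ _ X0.
  rewrite tensor01_sum; last by move=> f Y Z; exact: xilin.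
  rewrite Coo_sumE (bigD1 j)//= big1 => [|i ij].
    rewrite tensor01Z; last by move=> f Y Z; exact: xilin.
    rewrite xiE eqxx !CooE mulr1 addr0 => /eqP.
    by rewrite mulf_eq0 (negPf rp) orbF => /eqP.
  rewrite tensor01Z; last by move=> f Y Z; exact: xilin.
  by rewrite xiE (negPf ij) mulr0.
pose W := \sum_i \sum_j (w (E i) * (\adj gram) i j) *: E j.
have gWE k : g W (E k) = \det gram * w (E k).
  have lk := tensor02_left (E k); rewrite /W (tensor01_sum lk).
  transitivity (\sum_i w (E i) * (\adj gram *m gram) i k).
    apply: eq_bigr => i _; rewrite (tensor01_sum lk) mxE mulr_sumr.
    by apply: eq_bigr => j _; rewrite (tensor01Z lk) [gram _ _]mxE mulrA.
  rewrite mul_adj_mx (bigD1 k)//= big1 => [|i ik].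
    by rewrite mxE eqxx mulr1n addr0 mulrC.
  by rewrite mxE (negPf ik) mulr0n mulr0.
exists (rho * \det gram), (rho *: W); split; first by rewrite CooE mulf_neq0.
move=> Z; rewrite (tensor01Z (tensor02_left Z)) (expand _ _ (tensor02_right W)).
under eq_bigr do rewrite gWE mulrCA.
by rewrite -mulr_sumr -expand// mulrCA mulrA.
Qed.

Lemma smooth_local_quotient (F : M -> R) :
  (forall p, exists h u : C,
    h p != 0 /\ forall q, h q != 0 -> F q = u q / h q) ->
  smooth F.
Proof.
move=> loc d ad k; apply: Ck_local => x dx.
have [h [u [hx Fq]]] := loc (chart_inv d x).
have Cl (f : C) : Ck k (chart_img d) (f \o chart_inv d).
  have /asboolP sf : Coo_fun f \in smooth_pred (M := M) by exact: (valP f).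
  exact: sf.
pose U := chart_img d `&` (h \o chart_inv d) @^-1` [set y | y != 0].
have oU : open U.
  rewrite openE => y [dy hy]; apply: filterI.
    by apply: open_nbhs_nbhs; split => //; exact: chart_img_open.
  have ch : {for y, continuous (h \o chart_inv d)}.
    by apply: (Ck_continuous (Cl h)); rewrite inE.
  by apply: ch; apply: open_nbhs_nbhs; split => //; exact: open_neq.
exists U => //.
have Ud : U `<=` chart_img d by move=> y [].
have hU : {in U, forall y, (h \o chart_inv d) y != 0} by move=> y /[!inE] -[].
apply: (eq_Ck oU _ (CkM oU (sub_Ck Ud (Cl u)) (CkV oU hU (sub_Ck Ud (Cl h))))).
by move=> y /[!inE] -[dy hy]; rewrite /= Fq.
Qed.

(** The local solutions agree up to their scaling factors, so that the quotients
    glue. *)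
Theorem sharp (w : V -> C) : is_tensor01 w ->
  exists W : V, forall Z, g W Z = w Z.
Proof.
move=> lw.
have /choice[hW hWP] (p : M) : exists hW : C * V,
    hW.1 p != 0 /\ forall Z, g hW.2 Z = hW.1 * w Z.
  by have [h [W P]] := local_sharp p lw; exists (h, W).
pose h p := (hW p).1; pose L p := (hW p).2.
have h0 p : h p p != 0 by exact: (hWP p).1.
have gL p Z : g (L p) Z = h p * w Z by exact: (hWP p).2.
have cross p q f r : h p r * L q f r = h q r * L p f r.
  suff e : h p *: L q = h q *: L p.
    have := congr1 (fun X : V => X f) e; rewrite !vfZE => e'.
    by rewrite -!CooME e'.
  apply: metric_inj => Z.
  by rewrite !(tensor01Z (tensor02_left Z)) !gL mulrCA.
have glue p q f : h p q != 0 -> L q f q / h q q = L p f q / h p q.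
  move=> hpq; apply: (mulIf hpq); apply: (mulIf (h0 q)).
  by rewrite mulrAC !divfK// mulrC cross mulrC.
have sm (f : C) : (fun q => L q f q / h q q) \in smooth_pred (M := M).
  apply/asboolP/smooth_local_quotient => p; exists (h p), (L p f).
  by split=> // q; exact: glue.
pose D (f : C) : C^o := MkCoo (sm f).
have DE f p : D f p = L p f p / h p p by [].
have dD : D \in derivation_pred (M := M).
  apply/asboolP; split=> [a f f'|f f']; apply: CooP => p; rewrite !CooE !DE.
    by rewrite vfD vfZ !CooE; ring.
  by rewrite vfM !CooE; ring.
exists (VectorField dD) => Z; apply: CooP => p; apply: (mulfI (h0 p)).
rewrite -!CooME -gL -(tensor01Z (tensor02_left Z)).
suff -> : h p *: VectorField dD = L p by [].
apply: vf_ext => f q; rewrite vfZE CooE.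
have -> : VectorField dD f q = L q f q / h q q by [].
have [hpq|hpq] := eqVneq (h p q) 0; last by rewrite (glue p)// mulrC divfK.
have /esym/eqP := cross p q f q.
by rewrite hpq !mul0r mulf_eq0 (negPf (h0 q)) => /eqP.
Qed.

End Musical.

(** * Symmetric and skew-symmetric parts *)

Section Tensors02.
Variables (R : realType) (n : nat) (M : manifold R n).
Local Notation C := (Coo M).
Local Notation V := (vector_field M).

Section Bilinear.
Variable B : V -> V -> C.
Hypothesis tB : is_tensor02 B.

Lemma tensor02Dl X X' Y : B (X + X') Y = B X Y + B X' Y.
Proof. exact: (tensor01D (tensor02_left tB Y)). Qed.
Lemma tensor02Dr X Y Y' : B X (Y + Y') = B X Y + B X Y'.
Proof. exact: (tensor01D (tensor02_right tB X)). Qed.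
Lemma tensor02Nl X Y : B (- X) Y = - B X Y.
Proof. exact: (tensor01N (tensor02_left tB Y)). Qed.
Lemma tensor02Zl f X Y : B (f *: X) Y = f * B X Y.
Proof. exact: (tensor01Z (tensor02_left tB Y)). Qed.
Lemma tensor02Zr f X Y : B X (f *: Y) = f * B X Y.
Proof. exact: (tensor01Z (tensor02_right tB X)). Qed.
Lemma tensor02_0l Y : B 0 Y = 0.
Proof. exact: (tensor01_0 (tensor02_left tB Y)). Qed.

Lemma sym_part_tensor : is_tensor02 (sym_part B).
Proof.
by split=> f X X' Y; rewrite /sym_part tB.1 tB.2; apply: CooP => p;
  rewrite !CooE; ring.
Qed.

Lemma skew_part_tensor : is_tensor02 (skew_part B).
Proof.
by split=> f X X' Y; rewrite /skew_part tB.1 tB.2; apply: CooP => p;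
  rewrite !CooE; ring.
Qed.

End Bilinear.

Lemma sym_partC (B : V -> V -> C) X Y : sym_part B X Y = sym_part B Y X.
Proof. by rewrite /sym_part addrC. Qed.

Lemma skew_partC (B : V -> V -> C) X Y : skew_part B X Y = - skew_part B Y X.
Proof. by rewrite /skew_part -scalerN opprB. Qed.

Lemma parallel_parts (nabla : V -> V -> V) (B : V -> V -> C) :
  parallel02 nabla B <->
  parallel02 nabla (sym_part B) /\ parallel02 nabla (skew_part B).
Proof.
have covS X Y Z : cov02 nabla (sym_part B) X Y Z =
    2^-1 *: (cov02 nabla B X Y Z + cov02 nabla B X Z Y).
  rewrite /cov02 /sym_part vfZ vfD; apply: CooP => p; rewrite !CooE; ring.
have covK X Y Z : cov02 nabla (skew_part B) X Y Z =
    2^-1 *: (cov02 nabla B X Y Z - cov02 nabla B X Z Y).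
  rewrite /cov02 /skew_part vfZ vfD vfN; apply: CooP => p; rewrite !CooE; ring.
split=> [PB|[PS PK] X Y Z].
  by split=> X Y Z; rewrite ?covS ?covK !PB ?subr0 ?addr0 scaler0.
have -> : cov02 nabla B X Y Z =
    cov02 nabla (sym_part B) X Y Z + cov02 nabla (skew_part B) X Y Z.
  by rewrite covS covK; apply: CooP => p; rewrite !CooE; field.
by rewrite PS PK addr0.
Qed.

End Tensors02.

(** * Connections with prescribed torsion *)

Section GeneralizedRiemannian.
Variables (R : realType) (n : nat) (M : manifold R n).
Local Notation C := (Coo M).
Local Notation V := (vector_field M).
Variables (g F : V -> V -> C) (A : V -> V).
Hypotheses (tg : is_tensor02 g) (gC : forall X Y, g X Y = g Y X).
Hypothesis ng : Defs.nondegenerate g.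
Hypotheses (FC : forall X Y, F X Y = - F Y X).
Hypothesis FA : forall X Y, F X Y = g (A X) Y.
Implicit Types (nabla : V -> V -> V) (T : V -> V -> V) (X Y Z : V).

Lemma cov_skew_endo nabla X Y Z : parallel02 nabla g ->
  cov02 nabla F X Y Z = g (cov11 nabla A X Y) Z.
Proof.
move=> Pg; have := Pg X (A Y) Z.
rewrite /cov02 /cov11 !FA tensor02Dl// tensor02Nl// => /eqP.
rewrite subr_eq0 subr_eq => /eqP ->.
by apply: CooP => p; rewrite !CooE; ring.
Qed.

Lemma parallel_skew_endo nabla : parallel02 nabla g ->
  parallel02 nabla F <-> parallel11 nabla A.
Proof.
move=> Pg; split=> [PF X Y|PA X Y Z]; last first.
  by rewrite cov_skew_endo// PA tensor02_0l.
apply: (metric_inj tg ng) => Z.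
by rewrite -cov_skew_endo// PF tensor02_0l.
Qed.

Lemma ext_d_parallel nabla X Y Z : is_tensor02 F -> parallel02 nabla F ->
  let T := torsion nabla in
  ext_d F X Y Z = F (T X Y) Z + F (T Y Z) X + F (T Z X) Y.
Proof.
move=> tF PF /=.
have XF (U V' W : V) : U (F V' W) = F (nabla U V') W - F (nabla U W) V'.
  have /eqP := PF U V' W; rewrite /cov02 subr_eq0 subr_eq => /eqP->.
  by rewrite [F V' _]FC addrC.
rewrite /ext_d /torsion !XF !(tensor02Dl tF) !(tensor02Nl tF).
by apply: CooP => p; rewrite !CooE; ring.
Qed.

(** The correction that turns a torsion-free metric connection into a metric
    connection with torsion T. *)
Definition contorsion T X Y Z : C := 2^-1 *:
  (lower g T X Y Z + lower g T Z X Y - lower g T Y Z X).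

Definition differ_by_contorsion nablag nabla T :=
  forall X Y Z, g (nabla X Y) Z = g (nablag X Y) Z + contorsion T X Y Z.

(** The difference s of the two connections satisfies s(X, Y, Z) = - s(X, Z, Y),
    since both are metric, and s(X, Y, Z) - s(Y, X, Z) = t(X, Y, Z);
    substituting the latter in the contorsion and cancelling with the former
    leaves s. *)
Lemma koszul_contorsion nablag nabla T : levi_civita g nablag ->
  (forall X Y, torsion nabla X Y = T X Y) -> parallel02 nabla g ->
  differ_by_contorsion nablag nabla T.
Proof.
move=> [_ tor0 Pg] torT P X Y Z.
have s_skew (U V' W : V) : g (nabla U V') W + g V' (nabla U W) =
    g (nablag U V') W + g V' (nablag U W).
  have /eqP := Pg U V' W; have /eqP := P U V' W.
  rewrite /cov02 !subr_eq0 !subr_eq => /eqP-> /eqP.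
  by rewrite addrC => ->; rewrite addrC.
have s_tor (U V' W : V) : lower g T U V' W =
    (g (nabla U V') W - g (nabla V' U) W) -
    (g (nablag U V') W - g (nablag V' U) W).
  have := congr1 (g^~ W) (tor0 U V'); rewrite /lower -torT /torsion.
  rewrite tensor02_0l// !(tensor02Dl tg) !(tensor02Nl tg) => /eqP.
  by rewrite subr_eq0 => /eqP->.
rewrite /contorsion !s_tor; apply: CooP => p.
have at_p (U V' W : V) : g (nabla U V') W p + g (nabla U W) V' p =
    g (nablag U V') W p + g (nablag U W) V' p.
  by have := s_skew U V' W; rewrite ![g V' _]gC -!CooDE => ->.
have e1 := at_p X Y Z; have e2 := at_p Y X Z; have e3 := at_p Z X Y.
rewrite !CooE; lra.
Qed.

(** Written with A, the two terms F(nabla_X Y, Z) and F(Y, nabla_X Z) involve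
    the connection only through g(nabla_X -, -), where the contorsion can be
    substituted. *)
Lemma cov_skew_contorsion nablag nabla T X Y Z :
  (forall X Y, T X Y = - T Y X) -> differ_by_contorsion nablag nabla T ->
  let t := lower g T in
  cov02 nablag F X Y Z = cov02 nabla F X Y Z
    - 2^-1 *: (t X Y (A Z) + t Z X (A Y))
    - 2^-1 *: (t (A Z) X Y + t (A Z) Y X + t X (A Y) Z + t Z (A Y) X).
Proof.
move=> skT dT t.
have skt (U V' W : V) : t U V' W = - t V' U W.
  by rewrite /t /lower skT (tensor02Nl tg).
have Fl (U V' : V) : F U V' = - g U (A V') by rewrite FC FA gC.
have Fr (U V' : V) : F U V' = g V' (A U) by rewrite FA gC.
rewrite /cov02 [F (nablag X Y) Z]Fl [F (nabla X Y) Z]Fl.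
rewrite [F Y (nabla _ _)]Fr [F Y (nablag _ _)]Fr !dT /contorsion -/t.
rewrite (skt X Z) (skt (A Y) X) (skt Y (A Z)).
by apply: CooP => p; rewrite !CooE; ring.
Qed.

Lemma contorsion_parallel_metric nablag nabla T :
  (forall X Y, T X Y = - T Y X) -> parallel02 nablag g ->
  differ_by_contorsion nablag nabla T -> parallel02 nabla g.
Proof.
move=> skT Pg dT X Y Z; have := Pg X Y Z; rewrite /cov02.
have skt (U V' W : V) : lower g T U V' W = - lower g T V' U W.
  by rewrite /lower skT (tensor02Nl tg).
rewrite ![g Y _]gC !dT /contorsion (skt X Z) (skt Y X) (skt Z Y) => e.
have ep p : (X (g Z Y) - g (nablag X Y) Z - g (nablag X Z) Y) p = 0.
  by rewrite e.
by apply: CooP => p; have := ep p; rewrite !CooE => ?; lra.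
Qed.

Lemma contorsion_torsion nablag nabla T :
  (forall X Y, T X Y = - T Y X) -> (forall X Y, torsion nablag X Y = 0) ->
  differ_by_contorsion nablag nabla T -> forall X Y, torsion nabla X Y = T X Y.
Proof.
move=> skT tor0 dT X Y; apply: (metric_inj tg ng) => Z.
have := congr1 (g^~ Z) (tor0 X Y); rewrite /torsion tensor02_0l//.
rewrite !(tensor02Dl tg) !(tensor02Nl tg) !dT /contorsion.
have skt (U V' W : V) : lower g T U V' W = - lower g T V' U W.
  by rewrite /lower skT (tensor02Nl tg).
rewrite -[g (T X Y) Z]/(lower g T X Y Z) (skt Y X) (skt X Z) (skt Z Y) => e.
have ep p : (g (nablag X Y) Z - g (nablag Y X) Z - g (bracket X Y) Z) p = 0.
  by rewrite e.
by apply: CooP => p; have := ep p; rewrite !CooE => ?; lra.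
Qed.

Lemma contorsion_connection nablag nabla T : is_tensor12 T ->
  is_connection nablag -> differ_by_contorsion nablag nabla T ->
  is_connection nabla.
Proof.
move=> [Tl Tr] [c1 c2 c3] dT.
have TDr X Y Y' : T X (Y + Y') = T X Y + T X Y'.
  by have := Tr 1 X Y Y'; rewrite !scale1r.
have T0r X : T X 0 = 0 by apply: (@addrI _ (T X 0)); rewrite -TDr !addr0.
have T0l X : T 0 X = 0.
  have := Tl 1 0 0 X; rewrite !scale1r addr0 => e.
  by apply: (@addrI _ (T 0 X)); rewrite addr0 -e.
have TDl X X' Y : T (X + X') Y = T X Y + T X' Y.
  by have := Tl 1 X X' Y; rewrite !scale1r.
have TZr f X Y : T X (f *: Y) = f *: T X Y.
  by have := Tr f X Y 0; rewrite T0r !addr0.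
have TZl f X Y : T (f *: X) Y = f *: T X Y.
  by have := Tl f X 0 Y; rewrite T0l !addr0.
have gE := (tensor02Dl tg, tensor02Zl tg, tensor02Dr tg, tensor02Zr tg).
split=> [f X X' Y|X Y Y'|f X Y]; apply: (metric_inj tg ng) => Z.
- rewrite !gE !dT c1 /contorsion /lower Tl Tr !gE.
  by apply: CooP => p; rewrite !CooE; ring.
- rewrite !gE !dT c2 /contorsion /lower TDr TDl !gE.
  by apply: CooP => p; rewrite !CooE; ring.
- rewrite !gE !dT c3 /contorsion /lower TZr TZl !gE.
  by apply: CooP => p; rewrite !CooE; ring.
Qed.

(** For fixed X and Y the right-hand side of the formula is a one-form in Z, and
    g turns it into a vector field. *)
Lemma contorsion_exists nablag T : is_tensor12 T ->
  exists nabla, differ_by_contorsion nablag nabla T.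
Proof.
move=> [Tl Tr].
have /choice[D DP] (XY : V * V) : exists W : V, forall Z,
    g W Z = g (nablag XY.1 XY.2) Z + contorsion T XY.1 XY.2 Z.
  apply: (sharp tg ng) => f Z Z'; rewrite /contorsion /lower Tl Tr !tg.2 !tg.1.
  by apply: CooP => p; rewrite !CooE; ring.
by exists (fun X Y => D (X, Y)) => X Y Z; exact: (DP (X, Y)).
Qed.

End GeneralizedRiemannian.

Theorem theorem2p3 (R : realType) (n : nat) (M : manifold R n)
  (G : vector_field M -> vector_field M -> Coo M)
  (A : vector_field M -> vector_field M)
  (nablag : vector_field M -> vector_field M -> vector_field M) :
  let g := sym_part G in
  let F := skew_part G in
  generalized_riemannian G ->
  is_tensor11 A ->
  (forall X Y, F X Y = g (A X) Y) ->
  levi_civita g nablag ->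
  [/\ forall nabla, is_connection nabla ->
        (parallel02 nabla G <-> parallel02 nabla g /\ parallel02 nabla F) /\
        (parallel02 nabla g /\ parallel02 nabla F <->
         parallel02 nabla g /\ parallel11 nabla A),
      forall nabla, is_connection nabla -> parallel02 nabla G ->
        let T := torsion nabla in
        let t := lower g T in
        [/\ torsion_condition G A nablag T,
            forall X Y Z,
              ext_d F X Y Z = F (T X Y) Z + F (T Y Z) X + F (T Z X) Y &
            forall X Y Z,
              ext_d F X Y Z = - t X Y (A Z) - t Y Z (A X) - t Z X (A Y)] &
      forall T, is_torsion_tensor T -> torsion_condition G A nablag T ->
        let t := lower g T in
        let solution nabla :=
          [/\ is_connection nabla, forall X Y, torsion nabla X Y = T X Y &
              parallel02 nabla G] in
        (exists! nabla, solution nabla) /\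
        (forall nabla, solution nabla <->
          forall X Y Z, g (nabla X Y) Z =
            g (nablag X Y) Z + 2^-1 *: (t X Y Z + t Z X Y - t Y Z X))].
Proof.
move=> g F [tG ng] tA FA lc.
have tg : is_tensor02 g by exact: sym_part_tensor.
have tF : is_tensor02 F by exact: skew_part_tensor.
have gC X Y : g X Y = g Y X by exact: sym_partC.
have FC X Y : F X Y = - F Y X by exact: skew_partC.
have [cg tor0 Pg] := lc.
split=> [nabla cn|nabla cn PG T t|T [tT skT] cond t solution].
- split; first exact: parallel_parts.
  by split=> -[Pn P]; split=> //; apply/(parallel_skew_endo tg ng FA).
- have [Pn PF] := (parallel_parts nabla G).1 PG.
  have skT X Y : T X Y = - T Y X.
    rewrite /T /torsion; apply: vf_ext => f p; rewrite !vfE !CooE.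
    change (nabla X Y f p - nabla Y X f p - (X (Y f) p - Y (X f) p) =
      - (nabla Y X f p - nabla X Y f p - (Y (X f) p - X (Y f) p))).
    by ring.
  have dT := koszul_contorsion tg gC lc (fun X Y => erefl (T X Y)) Pn.
  have dF X Y Z := ext_d_parallel FC X Y Z tF PF.
  split=> [t' X Y Z|X Y Z|X Y Z].
  + rewrite [LHS](cov_skew_contorsion tg gC FC FA _ _ _ skT dT) PF.
    by rewrite sub0r.
  + exact: dF.
  + have Ft U W : F U W = - g U (A W) by rewrite FC FA gC.
    by rewrite dF !Ft.
- have solE nabla : solution nabla <-> differ_by_contorsion g nablag nabla T.
    split=> [[cn torT PG]|dT].
      exact: koszul_contorsion lc torT ((parallel_parts nabla G).1 PG).1.
    have Pn := contorsion_parallel_metric tg gC skT Pg dT.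
    split; first exact: contorsion_connection dT.
      exact: contorsion_torsion dT.
    apply/parallel_parts; split=> // X Y Z.
    have := cov_skew_contorsion tg gC FC FA X Y Z skT dT.
    by rewrite cond => /addIr; rewrite -[LHS]add0r => /addIr/esym.
  split=> //.
  have [nabla dT] := contorsion_exists tg ng nablag tT.
  exists nabla; split; first exact/solE.
  move=> nabla' /solE dT'; apply/funext => X; apply/funext => Y.
  by apply: (metric_inj tg ng) => Z; rewrite dT dT'.
Qed.
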